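(* Consider the multi-component Curie–Weiss Ising model described in the context, with $\beta<\beta_{cr}$. Then the Glauber dynamics exhibits a cutoff at time $t_n:=\alpha n\log n$ with window of size $n$, i.e. \[ \lim_{\gamma\to\infty}\limsup_{n\to\infty} d_n(t_n+\gamma n)=0 \quad\text{and}\quad \lim_{\gamma\to\infty}\liminf_{n\to\infty} d_n(t_n-\gamma n)=1 , \] where $\alpha=\alpha(\beta,p_i,k_{ij})$ and $\beta_{cr}=\beta_{cr}(p_i,k_{ij})$ are the constants defined in the context (in particular they do not depend on $n$).
   Context: Fix an integer $m\ge 1$, proportions $p_1,\dots,p_m>0$ with $\sum_i p_i=1$, and a symmetric matrix $\mathbf K=(k_{ij})_{1\le i,j\le m}$ with $k_{ij}>0$ for $i\neq j$ and $k_{ii}\ge 0$ (vanishing intra-block interaction $k_{ii}=0$ is allowed). The parameter $n$ ranges over positive integers with $np_i\in\mathbb N$ for all $i$. The vertex set $V=\{1,\dots,n\}$ is partitioned into blocks $G_1,\dots,G_m$ with $|G_i|=np_i$; for $v\in G_i,w\in G_j$ put $K(v,w)=k_{ij}/n$. The state space is $\Omega=\{-1,+1\}^V$ and, for inverse temperature $\beta\ge0$, the Gibbs measure is $\mu_n(\sigma)\propto\exp\big(\beta\sum_{\{v,w\},v\ne w}K(v,w)\sigma(v)\sigma(w)\big)$. The Glauber dynamics $(\sigma_t)_{t\ge0}$ is the discrete-time Markov chain which at each step picks a vertex $v$ uniformly from $V$ and sets the spin at $v$ to $\pm1$ with probability $r_\pm(S^v)=\frac{1\pm\tanh(\beta S^v)}{2}$,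 where $S^v=\sum_{w\ne v}K(v,w)\sigma(w)$, leaving all other spins unchanged; $\mu_n$ is its stationary distribution. Let $d_n(t)=\max_{\sigma\in\Omega}\|\mathbb P_\sigma(\sigma_t\in\cdot)-\mu_n\|_{TV}$ (times are rounded to integers). Let $\mathbf B=(p_ik_{ij})_{i,j}$ and $\mathbf Q_n=(1-\frac1n)\mathbf I_m+\frac{\beta}{n}\mathbf B$ ($\mathbf I_m$ the $m\times m$ identity). Let $\rho_n$ be the largest (Perron) eigenvalue of $\mathbf Q_n$ and $\mathbf a=(a_1,\dots,a_m)^\top>0$ its left Perron eigenvector normalized by $\|\mathbf a\|_1=1$ (it is also the left Perron eigenvector of $\mathbf B$ and does not depend on $n$). Define $\alpha:=\frac{1}{2n(1-\rho_n)}$ and $\beta_{cr}:=\big(\sum_{i,j=1}^m a_ip_ik_{ij}\big)^{-1}$. *)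

(* Defs.v *)
From HB Require Import structures.
From mathcomp Require Import all_boot all_order all_algebra.
From mathcomp Require Import all_classical all_reals all_analysis.
Set Implicit Arguments. Unset Strict Implicit. Unset Printing Implicit Defensive.
Import Order.TTheory GRing.Theory Num.Theory.
Local Open Scope ring_scope.

Section CurieWeiss.
Variables (R : realType) (m : nat) (p : 'I_m -> R) (k : 'M[R]_m) (beta : R).

Definition valid (n : nat) : Prop :=
  (0 < n)%N /\ forall i : 'I_m, exists c : nat, n%:R * p i = c%:R.

Definition spin (b : bool) : R := if b then 1 else -1.

Definition tanhR (x : R) : R := (expR x - expR (- x)) / (expR x + expR (- x)).

Section Fixed_n.
Variables (n : nat) (blk : 'I_n -> 'I_m). (* blk v = index i of the block G_i containing v *)

Definition config := {ffun 'I_n -> bool}.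

Definition Kint (v w : 'I_n) : R := k (blk v) (blk w) / n%:R.

Definition locfield (s : config) (v : 'I_n) : R :=
  \sum_(w : 'I_n | w != v) Kint v w * spin (s w).

Definition rate (S : R) (b : bool) : R := (1 + spin b * tanhR (beta * S)) / 2.

Definition glauber (s t : config) : R :=
  n%:R^-1 * \sum_(v : 'I_n)
    (if [forall w, (w != v) ==> (t w == s w)] then rate (locfield s v) (t v) else 0).

Definition hamil (s : config) : R :=
  \sum_(v : 'I_n) \sum_(w : 'I_n | (v < w)%N) Kint v w * spin (s v) * spin (s w).

Definition gibbs (s : config) : R :=
  expR (beta * hamil s) / \sum_(t : config) expR (beta * hamil t).

Fixpoint Pt (t : nat) (s u : config) : R :=
  match t with
  | 0 => (s == u)%:R
  | t'.+1 => \sum_(r : config) Pt t' s r * glauber r u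
  end.

Definition tvdist (mu nu : config -> R) : R := 2^-1 * \sum_(u : config) `|mu u - nu u|.

Definition dist_n (t : nat) : R := \big[Num.max/0]_(s : config) tvdist (Pt t s) gibbs.

End Fixed_n.

Definition Bmat : 'M[R]_m := \matrix_(i, j) (p i * k i j).

Definition Qmat (n : nat) : 'M[R]_m :=
  (1 - n%:R^-1) *: 1%:M + (beta / n%:R) *: Bmat.

Definition perron (A : 'M[R]_m) : R := sup [set x : R | eigenvalue A x].

Definition alpha (n : nat) : R := (2 * n%:R * (1 - perron (Qmat n)))^-1.

Definition beta_cr (a : 'rV[R]_m) : R := (\sum_i \sum_j a 0 i * p i * k i j)^-1.

Definition tn (n : nat) : R := alpha n * n%:R * ln n%:R.

End CurieWeiss.

(* Main.v *)
Require Import Defs.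
From mathcomp Require Import all_boot all_order all_algebra.
From mathcomp Require Import all_classical all_reals all_analysis.
From mathcomp Require Import ring lra zify.
Set Implicit Arguments. Unset Strict Implicit. Unset Printing Implicit Defensive.
Import Order.TTheory GRing.Theory Num.Theory.
Import numFieldNormedType.Exports.
Local Open Scope ring_scope.
Local Open Scope classical_set_scope.

(** The gradient D_v g(s) = g(s^v) - g(s) of a function g of the configuration evolves under the transition operator P by an averaged copy of itself plus the influence of the other spins, since |D_v| of the flip rate at w is at most beta K(v,w). With the Perron vector as weights, the blockwise l2 norms of the gradient are therefore contracted by q = 1 - (1 - lam)/n at each step, where lam = beta / beta_cr < 1.

Upper bound: telescoping the one-step variances and comparing gradients pointwise gives a reverse Poincare inequality, so that after n steps any g with |g| <= 1 has bounded squared gradient. The contraction then makes it O(q^(2t)) after t further steps, and joining two configurations by a greedy path turns this into an oscillation O(sqrt n q^t), which bounds the total variation distance.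

Lower bound: the projection of the block magnetizations on the Perron vector has variance O(1/n) along the chain by the contraction and second moment O(1/n) at equilibrium. Started from a small magnetization of order 1, its mean is at least a multiple of q^t up to O(1/n): subtracting a multiple of the quadratic energy gives a Lyapunov function whose drift absorbs the error made by replacing tanh x by x. A second moment estimate concludes. *)

(** * Jensen, Cauchy-Schwarz and Minkowski inequalities for finite weighted sums *)

Section WeightedSums.
Context {R : realType} {I : finType}.
Implicit Types (P : pred I) (w x y : I -> R).

(** Lagrange's identity: the difference of the two sides is half the double sum of
    [w i * w j * (x i - x j) ^+ 2]. The total weight is kept as a factor because it is below one in
    the contraction estimates. *)
Lemma jensen_sqr P w x : (forall i, P i -> 0 <= w i) ->
  (\sum_(i | P i) w i * x i) ^+ 2
    <= (\sum_(i | P i) w i) * \sum_(i | P i) w i * x i ^+ 2.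
Proof.
move=> w0; rewrite -subr_ge0.
suff -> : (\sum_(i | P i) w i) * (\sum_(i | P i) w i * x i ^+ 2) -
    (\sum_(i | P i) w i * x i) ^+ 2 =
    2^-1 * \sum_(i | P i) \sum_(j | P j) w i * w j * (x i - x j) ^+ 2.
  rewrite mulr_ge0 ?invr_ge0 //; apply: sumr_ge0 => i Pi.
  by apply: sumr_ge0 => j Pj; rewrite mulr_ge0 ?sqr_ge0 ?mulr_ge0 ?w0.
have -> : \sum_(i | P i) \sum_(j | P j) w i * w j * (x i - x j) ^+ 2 =
  \sum_(i | P i) (w i * x i ^+ 2 * (\sum_(j | P j) w j) +
    w i * (\sum_(j | P j) w j * x j ^+ 2) -
    2 * (w i * x i * \sum_(j | P j) w j * x j)).
  apply: eq_bigr => i Pi; rewrite !mulr_sumr -big_split -sumrB /=.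
  by apply: eq_bigr => j Pj; ring.
rewrite sumrB big_split /= -mulr_sumr -!mulr_suml.
by field.
Qed.

(** One point of weight [w0] is adjoined to the family, for the mass of a chain that stays put; the
    extra defect is [w0] times the weighted sum of [(x i - x0) ^+ 2]. *)
Lemma jensen_sqr_lazy P (w0 x0 : R) w x : 0 <= w0 ->
  (forall i, P i -> 0 <= w i) ->
  (w0 * x0 + \sum_(i | P i) w i * x i) ^+ 2
    <= (w0 + \sum_(i | P i) w i) *
       (w0 * x0 ^+ 2 + \sum_(i | P i) w i * x i ^+ 2).
Proof.
move=> w00 wP; have J := jensen_sqr x wP.
have : 0 <= \sum_(i | P i) w i * (x i - x0) ^+ 2.
  by apply: sumr_ge0 => i Pi; rewrite mulr_ge0 ?sqr_ge0 ?wP.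
have -> : \sum_(i | P i) w i * (x i - x0) ^+ 2 =
   \sum_(i | P i) w i * x i ^+ 2 - 2 * x0 * (\sum_(i | P i) w i * x i) +
   x0 ^+ 2 * \sum_(i | P i) w i.
  rewrite !mulr_sumr -sumrB -big_split /=; apply: eq_bigr => i _; ring.
move: J; set S0 := \sum_(i | P i) w i; set S1 := \sum_(i | P i) w i * x i.
set S2 := \sum_(i | P i) w i * x i ^+ 2 => J H.
have {}H := mulr_ge0 w00 H.
rewrite -subr_ge0; apply: le_trans (_ : 0 <= (S0 * S2 - S1 ^+ 2) + w0 * (S2 - 2 * x0 * S1 + x0 ^+ 2 * S0)) _.
  by rewrite addr_ge0 // subr_ge0.
by rewrite le_eqVlt; apply/orP; left; apply/eqP; ring.
Qed.

Lemma sqr_sum_card P x :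
  (\sum_(i | P i) x i) ^+ 2 <= #|P|%:R * \sum_(i | P i) x i ^+ 2.
Proof.
have := @jensen_sqr P (fun=> 1) x (fun _ _ => ler01).
rewrite sumr_const.
by under [X in X ^+ 2]eq_bigr do rewrite mul1r;
   under [X in _ * X]eq_bigr do rewrite mul1r.
Qed.

(** Cauchy-Schwarz: the mean is at most the root mean square. *)
Lemma sum_le_of_sqr P x (e : R) : 0 <= e ->
  \sum_(i | P i) x i ^+ 2 <= #|P|%:R * e ^+ 2 ->
  \sum_(i | P i) x i <= #|P|%:R * e.
Proof.
move=> e0 H; apply: le_trans (ler_norm _) _.
rewrite -(@ler_pXn2r _ 2) ?nnegrE ?mulr_ge0 //.
rewrite real_normK ?num_real //; apply: le_trans (sqr_sum_card _ _) _.
by rewrite exprMn [X in _ <= X * _]expr2 -mulrA ler_wpM2l.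
Qed.

(** Minkowski's inequality for the normalized l2 norm when the second vector is constant. *)
Lemma sum_sqr_shift P x (e f : R) : 0 <= e -> 0 <= f ->
  \sum_(i | P i) x i ^+ 2 <= #|P|%:R * e ^+ 2 ->
  \sum_(i | P i) (x i + f) ^+ 2 <= #|P|%:R * (e + f) ^+ 2.
Proof.
move=> e0 f0 H.
have H1 := sum_le_of_sqr e0 H.
have -> : \sum_(i | P i) (x i + f) ^+ 2 =
  \sum_(i | P i) x i ^+ 2 + 2 * f * (\sum_(i | P i) x i) + #|P|%:R * f ^+ 2.
  have -> : #|P|%:R * f ^+ 2 = \sum_(i | P i) f ^+ 2.
    by rewrite sumr_const mulr_natl.
  rewrite mulr_sumr -!big_split /=; apply: eq_bigr => i _; ring.
have : 2 * f * (\sum_(i | P i) x i) <= 2 * f * (#|P|%:R * e).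
  by rewrite ler_wpM2l // mulr_ge0.
move: H; set X := \sum_(i | P i) _; set Y := \sum_(i | P i) _ => H K; nra.
Qed.

End WeightedSums.

(** * The hyperbolic tangent: monotonicity, Lipschitz bound and linearization *)

Section Tanh.
Context {R : realType}.
Implicit Types x y : R.

Lemma tanhRE x : tanhR x = 1 - 2 / (expR (2 * x) + 1).
Proof.
have e0 := expR_gt0 x; rewrite /tanhR expRN [2 * x](_ : _ = x + x); last by ring.
rewrite expRD; field.
by rewrite !gt_eqF ?addr_gt0 ?mulr_gt0.
Qed.

Lemma tanhRN x : tanhR (- x) = - tanhR x.
Proof. by rewrite /tanhR opprK -[RHS]mulNr opprB; congr (_ / _); rewrite addrC. Qed.

Lemma tanhR0 : tanhR (0 : R) = 0.
Proof. by rewrite /tanhR oppr0 subrr mul0r. Qed.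

Lemma tanhR_lt1 x : tanhR x < 1.
Proof. by rewrite tanhRE ltrBlDr ltrDl divr_gt0 // addr_gt0 ?expR_gt0. Qed.

Lemma ler_tanhR x y : x <= y -> tanhR x <= tanhR y.
Proof.
move=> xy; rewrite !tanhRE lerD2l lerN2 ler_wpM2l //.
rewrite lef_pV2 ?posrE ?addr_gt0 ?expR_gt0 //.
by rewrite lerD2r ler_expR ler_wpM2l.
Qed.

Lemma is_derive_tanhR x : is_derive x (1 : R) (@tanhR R) (1 - tanhR x ^+ 2).
Proof.
have -> : @tanhR R = (fun y => 1 - 2 * (expR (2 * y) + 1)^-1).
  by apply/funext => y; rewrite tanhRE.
have e0 y : expR (2 * y) + 1 != 0 :> R.
  by rewrite gt_eqF // addr_gt0 ?expR_gt0.
have dc (c : R) : is_derive x (1 : R) (cst c : R -> R) 0 by exact: is_derive_cst.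
have d2 : is_derive x (1 : R) (cst 2 * id : R -> R) 2.
  apply: is_derive_eq (is_deriveM (dc 2) (is_derive_id x 1)) _.
  by rewrite /GRing.scale /= mulr1 mulr0 addr0.
have d : is_derive x (1 : R) (fun y => expR (2 * y) + 1 : R) (2 * expR (2 * x)).
  have d3 := is_derive1_comp (is_derive_expR (2 * x)) d2.
  by apply: is_derive_eq (is_deriveD d3 (dc 1)) _; rewrite addr0 mulrC.
have D := is_deriveB (dc 1) (is_deriveM (dc 2) (@is_deriveV R (fun y => expR (2 * y) + 1) x _ 1 (e0 x) d)).
apply: (is_derive_eq D).
rewrite /GRing.scale /=; field; exact: e0.
Qed.

Lemma tanhR_MVT x y : x <= y ->
  exists2 c, x <= c <= y & tanhR y - tanhR x = (1 - tanhR c ^+ 2) * (y - x).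
Proof.
move=> xy.
have [||c cI E] := @MVT_segment R (@tanhR R) (fun x => 1 - tanhR x ^+ 2) x y xy.
- by move=> z _; apply: is_derive_tanhR.
- apply: derivable_within_continuous => z _.
  by have := is_derive_tanhR z; case.
by exists c => //; rewrite itvE in cI.
Qed.

Lemma tanhR_gtN1 x : -1 < tanhR x.
Proof. by rewrite -ltrN2 opprK -tanhRN tanhR_lt1. Qed.

Lemma tanhR_lip x y : `|tanhR x - tanhR y| <= `|x - y|.
Proof.
wlog xy : x y / y <= x.
  move=> H; have [/H//|/ltW/H] := leP y x.
  by rewrite distrC [`|y - x|]distrC.
have [c _ ->] := tanhR_MVT xy.
rewrite normrM ler_piMl // ger0_norm.
  by rewrite lerBlDr lerDl sqr_ge0.
have := tanhR_gtN1 c; have := tanhR_lt1 c; set t := tanhR c; nra.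
Qed.

(** For nonnegative x, the mean value theorem gives [x - tanh x = tanh(c)^2 x] with c between 0 and
    x, and [tanh(c)^2 <= tanh c <= x]. A quadratic error suffices, since a quadratic energy will
    absorb it. *)
Lemma tanhR_quad x : `|tanhR x - x| <= x ^+ 2.
Proof.
wlog x0 : x / 0 <= x.
  move=> H; have [/H//|xn] := leP 0 x.
  have := H (- x); rewrite oppr_ge0 tanhRN sqrrN => /(_ (ltW xn)).
  by rewrite -opprD normrN.
have [c /andP[c0 cx]] := tanhR_MVT x0.
rewrite tanhR0 !subr0 => ->.
have t0 : 0 <= tanhR c by rewrite -tanhR0 ler_tanhR.
have t1 := tanhR_lt1 c.
have tc : tanhR c <= c.
  by have := tanhR_lip c 0; rewrite tanhR0 !subr0 !ger0_norm.
rewrite mulrBl mul1r addrAC subrr add0r normrN ger0_norm; last first.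
  by rewrite mulr_ge0 ?sqr_ge0.
rewrite [leRHS]expr2 ler_wpM2r //; set t := tanhR c in t0 t1 tc *; nra.
Qed.

End Tanh.

(** * Single spin flips and the discrete gradient *)

Section Flip.
Context {R : realType} {n : nat}.
Implicit Types (s : config n) (v w : 'I_n) (g h : config n -> R).

Definition flip s v : config n := [ffun w => if w == v then ~~ s w else s w].

Lemma flipE s v w : flip s v w = if w == v then ~~ s w else s w.
Proof. by rewrite ffunE. Qed.

Lemma flipK v : involutive (flip^~ v).
Proof. by move=> s; apply/ffunP => w; rewrite !flipE; case: eqP; rewrite ?negbK. Qed.

Lemma flipC s v w : flip (flip s v) w = flip (flip s w) v.
Proof. by apply/ffunP => u; rewrite !flipE; case: eqP; case: eqP. Qed.

Definition dflip v g s := g (flip s v) - g s.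

Definition gradsq g s := \sum_v dflip v g s ^+ 2.

Lemma dflip_flip v g s : dflip v g (flip s v) = - dflip v g s.
Proof. by rewrite /dflip flipK opprB. Qed.

(** Symmetry of the mixed second difference; it lets the gradient at v pass through an update at
    w. *)
Lemma dflip_comm v w g s :
  dflip w g (flip s v) - dflip w g s = dflip v g (flip s w) - dflip v g s.
Proof. by rewrite /dflip (flipC s v w); ring. Qed.

Lemma gradsq_ge0 g s : 0 <= gradsq g s.
Proof. by apply: sumr_ge0 => v _; apply: sqr_ge0. Qed.

(* Greedy path from s to s': always flip the disagreeing site with the smallest increment, which is at most B divided by the square root of the number of disagreements. *)
Lemma path_bound g (B : R) s s' : 0 <= B -> (forall u, gradsq g u <= B ^+ 2) ->
  `|g s - g s'| <= 2 * B * Num.sqrt n%:R.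
Proof.
move=> B0 HB.
suff H d : forall s, #|[pred v | s v != s' v]| = d ->
    `|g s - g s'| <= 2 * B * Num.sqrt d%:R.
  apply: le_trans (H _ s erefl) _; rewrite ler_wpM2l ?mulr_ge0 //.
  by rewrite ler_sqrt // ler_nat -[leqRHS](card_ord n) max_card.
elim: d {s} => [|d IH] s.
  move=> /card0_eq H.
  have -> : s = s' by apply/ffunP => v; have := H v; rewrite inE => /negbFE/eqP.
  by rewrite subrr normr0 mulr_ge0 ?sqrtr_ge0 ?mulr_ge0.
move=> sd; set A := [pred v | s v != s' v] in sd.
have [v vA vB] : exists2 v, v \in A & `|dflip v g s| <= B / Num.sqrt d.+1%:R.
  apply: contrapT => H.
  have {}H v : v \in A -> B / Num.sqrt d.+1%:R < `|dflip v g s|.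
    by move=> vA; rewrite ltNge; apply/negP => K; apply: H; exists v.
  have : B ^+ 2 < gradsq g s.
    have -> : B ^+ 2 = \sum_(v in A) (B / Num.sqrt d.+1%:R) ^+ 2.
      rewrite sumr_const sd exprMn exprVn sqr_sqrtr // -[RHS]mulr_natr.
      by rewrite mulfVK // pnatr_eq0.
    rewrite /gradsq [ltRHS](bigID (mem A)) /= ltr_wpDr //.
      by apply: sumr_ge0 => v _; apply: sqr_ge0.
    have /card_gt0P[v0 v0A] : (0 < #|A|)%N by rewrite sd.
    apply: ltr_sum; last first.
      by move=> v /= vA; rewrite -[ltRHS]real_normK ?num_real // ltr_pXn2r ?nnegrE ?divr_ge0 ?sqrtr_ge0 ?H.
    by apply/hasP; exists v0 => //; rewrite mem_index_enum.
  by rewrite ltNge HB.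
have := IH (flip s v); rewrite (cardD1 v) vA add1n in sd.
case: sd => sd /(_ _).
have -> : #|[pred w | flip s v w != s' w]| = d.
  rewrite -sd; apply: eq_card => w; rewrite !inE flipE.
  case: (eqVneq w v) => [->|_] //=.
  by move: vA; rewrite inE; case: (s v); case: (s' v).
move=> /(_ erefl) {}IH.
apply: le_trans (_ : `|dflip v g s| + `|g (flip s v) - g s'| <= _).
  rewrite [_ + `|g _ - _|]addrC; apply: le_trans (ler_normB _ _).
  by rewrite /dflip le_eqVlt; apply/orP; left; apply/eqP; congr `|_|; ring.
apply: le_trans (lerD vB IH) _.
set x := Num.sqrt d.+1%:R; set y := Num.sqrt d%:R.
have x0 : 0 < x by rewrite sqrtr_gt0 ltr0Sn.
have y0 : 0 <= y by apply: sqrtr_ge0.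
have E : x ^+ 2 = y ^+ 2 + 1.
  by rewrite !sqr_sqrtr // -addn1 natrD.
rewrite [B / x + _](_ : _ = B * (x^-1 + 2 * y)); last by ring.
rewrite [2 * B * x](_ : _ = B * (2 * x)); last by ring.
rewrite ler_wpM2l // -(ler_pM2r x0) mulrDl mulVf ?gt_eqF //.
(* As [x^2 = y^2 + 1], the goal [1 + 2xy <= 2x^2] is [(x - y)^2 >= 0]. *)
have := sqr_ge0 (x - y); nra.
Qed.

End Flip.

(** * Transition operators of single-site flip chains and their variances *)

Section SpinFlipStep.
Context {R : realType} {n : nat} (f : config n -> 'I_n -> R).
Implicit Types (s : config n) (v w : 'I_n) (g h : config n -> R).

(** The Markov operator P acting on functions, for the chain that picks a uniform site w and flips
    it with probability [f s w]. Its iterates are the expectations after t steps. *)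
Definition step g s := g s + n%:R^-1 * \sum_w f s w * dflip w g s.

Lemma stepE g s : step g s =
  (1 - n%:R^-1 * \sum_w f s w) * g s + n%:R^-1 * \sum_w f s w * g (flip s w).
Proof.
rewrite /step mulrBl mul1r -addrA; congr (_ + _).
rewrite -mulrA addrC -mulrBr mulr_suml -sumrB; congr (_ * _).
by apply: eq_bigr => w _; rewrite -mulrBr.
Qed.

Lemma stepD g h s : step (fun u => g u + h u) s = step g s + step h s.
Proof.
rewrite /step addrACA -mulrDr -big_split /=; congr (_ + _ * _).
by apply: eq_bigr => w _; rewrite /dflip; ring.
Qed.

Lemma stepZ c g s : step (fun u => c * g u) s = c * step g s.
Proof.
rewrite /step mulrDr mulrCA; congr (_ + _ * _); rewrite mulr_sumr.
by apply: eq_bigr => w _; rewrite /dflip; ring.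
Qed.

Lemma step_cst c s : step (fun=> c) s = c.
Proof.
by rewrite /step big1 ?mulr0 ?addr0 // => w _; rewrite /dflip subrr mulr0.
Qed.

Lemma iter_stepD t g h s :
  iter t step (fun u => g u + h u) s = iter t step g s + iter t step h s.
Proof.
elim: t s => //= t IH s.
by rewrite -stepD; congr (step _ s); apply/funext => u; apply: IH.
Qed.

Lemma iter_stepZ t c g s : iter t step (fun u => c * g u) s = c * iter t step g s.
Proof.
elim: t s => //= t IH s.
by rewrite -stepZ; congr (step _ s); apply/funext => u; apply: IH.
Qed.

Lemma iter_step_cst t c s : iter t step (fun=> c) s = c.
Proof.
elim: t s => //= t IH s.
by rewrite -[RHS](step_cst c s); congr (step _ s); apply/funext => u; apply: IH.
Qed.

(** The left side is the variance of g after t steps. Each summand is [P^(t-i) (P^i g)^2 - P^(t-i-1)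
    (P^(i+1) g)^2], so the sum telescopes; it is an average of one-step variances. *)
Lemma iter_step_variance t g s :
  iter t step (fun u => g u ^+ 2) s - iter t step g s ^+ 2 =
  \sum_(i < t) iter (t.-1 - i) step
     (fun u => step (fun x => iter i step g x ^+ 2) u - step (iter i step g) u ^+ 2) s.
Proof.
elim: t s => [|t IH] s; first by rewrite big_ord0 subrr.
rewrite big_ord_recr /= subnn /=.
have -> : \sum_(i < t) iter (t - i) step
     (fun u => step (fun x => iter i step g x ^+ 2) u - step (iter i step g) u ^+ 2) s
  = step (fun s => iter t step (fun u => g u ^+ 2) s - iter t step g s ^+ 2) s.
  have -> : (fun s => iter t step (fun u => g u ^+ 2) s - iter t step g s ^+ 2)
    = fun s => \sum_(i < t) iter (t.-1 - i) step
     (fun u => step (fun x => iter i step g x ^+ 2) u - step (iter i step g) u ^+ 2) s.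
    by apply/funext => u; apply: IH.
  have SS (I : finType) (F : I -> config n -> R) :
     step (fun u => \sum_i F i u) s = \sum_i step (F i) s.
    rewrite /step big_split /= -mulr_sumr exchange_big /=; congr (_ + _ * _).
    by apply: eq_bigr => w _; rewrite /dflip -sumrB mulr_sumr.
  rewrite SS; apply: eq_bigr => i _.
  have -> : (t - i = (t.-1 - i).+1)%N by have := ltn_ord i; lia.
  by [].
have -> : step (fun s => iter t step (fun u => g u ^+ 2) s - iter t step g s ^+ 2) s
  = step (iter t step (fun u => g u ^+ 2)) s - step (fun s => iter t step g s ^+ 2) s.
  rewrite -[- step _ s]mulN1r -stepZ -stepD; congr (step _ s).
  by apply/funext => u; rewrite mulN1r.
by rewrite addrA subrK.
Qed.

Hypothesis n_gt0 : (0 < n)%N.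
Hypothesis f01 : forall s w, 0 <= f s w <= 1.

Let n0 : 0 < n%:R :> R. Proof. by rewrite ltr0n. Qed.

Lemma stay_ge0 s : 0 <= 1 - n%:R^-1 * \sum_w f s w.
Proof.
rewrite subr_ge0 mulrC ler_pdivrMr // mul1r.
apply: le_trans (_ : \sum_(w < n) 1 <= _).
  by apply: ler_sum => w _; have /andP[] := f01 s w.
by rewrite sumr_const card_ord.
Qed.

Lemma le_step g h s : (forall u, g u <= h u) -> step g s <= step h s.
Proof.
move=> gh; rewrite !stepE lerD // ?ler_wpM2l ?stay_ge0 ?invr_ge0 ?ler0n //.
by apply: ler_sum => w _; rewrite ler_wpM2l //; have /andP[] := f01 s w.
Qed.

Lemma step_ge_flips h s : (forall u, 0 <= h u) ->
  n%:R^-1 * \sum_w f s w * h (flip s w) <= step h s.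
Proof. by move=> h0; rewrite stepE lerDr mulr_ge0 ?stay_ge0. Qed.

Lemma le_iter_step t g h s : (forall u, g u <= h u) ->
  iter t step g s <= iter t step h s.
Proof. by move=> gh; elim: t s => //= t IH s; apply: le_step. Qed.

(** A variance is at most the second moment of the increment, and the rates are at most one. *)
Lemma step_variance_le g s :
  step (fun x => g x ^+ 2) s - step g s ^+ 2 <= n%:R^-1 * gradsq g s.
Proof.
apply: le_trans (_ : n%:R^-1 * \sum_w f s w * dflip w g s ^+ 2 <= _).
  rewrite /step.
  have -> : \sum_w f s w * dflip w (fun x => g x ^+ 2) s =
    \sum_w f s w * dflip w g s ^+ 2 + 2 * g s * \sum_w f s w * dflip w g s.
    rewrite mulr_sumr -big_split /=; apply: eq_bigr => w _.
    by rewrite /dflip; ring.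
  set A := \sum_w _; set B := \sum_w _.
  have := sqr_ge0 (n%:R^-1 * B); nra.
rewrite ler_wpM2l ?invr_ge0 ?ler0n //; apply: ler_sum => w _.
by rewrite ler_piMl ?sqr_ge0 //; have /andP[] := f01 s w.
Qed.

(** The chain moves with probability at most [1 - r0], so by Cauchy-Schwarz the squared mean
    increment takes at most the fraction [1 - r0] of the second moment. The second factor [r0]
    bounds the rates from below. *)
Lemma step_variance_ge (r0 : R) g s : 0 <= r0 ->
  (forall s w, r0 <= f s w <= 1 - r0) ->
  r0 ^+ 2 / n%:R * gradsq g s <= step (fun x => g x ^+ 2) s - step g s ^+ 2.
Proof.
move=> r00 fr.
rewrite /step.
have -> : \sum_w f s w * dflip w (fun x => g x ^+ 2) s =
    \sum_w f s w * dflip w g s ^+ 2 + 2 * g s * \sum_w f s w * dflip w g s.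
  rewrite mulr_sumr -big_split /=; apply: eq_bigr => w _.
  by rewrite /dflip; ring.
have J : (\sum_w f s w * dflip w g s) ^+ 2 <= (\sum_w f s w) * \sum_w f s w * dflip w g s ^+ 2.
  by apply: jensen_sqr => w _; have /andP[] := f01 s w.
have S1 : n%:R^-1 * \sum_w f s w <= 1 - r0.
  rewrite mulrC ler_pdivrMr //.
  apply: le_trans (_ : \sum_(w < n) (1 - r0) <= _).
    by apply: ler_sum => w _; have /andP[] := fr s w.
  by rewrite sumr_const card_ord mulr_natr.
have G : r0 * gradsq g s <= \sum_w f s w * dflip w g s ^+ 2.
  rewrite mulr_sumr; apply: ler_sum => w _.
  by rewrite ler_wpM2r ?sqr_ge0 //; have /andP[] := fr s w.
move: J S1 G; set A := \sum_w f s w * dflip w g s ^+ 2.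
set B := \sum_w f s w * dflip w g s; set F := \sum_w f s w => J S1 G.
have A0 : 0 <= A.
  by apply: sumr_ge0 => w _; rewrite mulr_ge0 ?sqr_ge0 //; have /andP[] := f01 s w.
have ni : 0 < n%:R^-1 :> R by rewrite invr_gt0.
move: ni S1; set N := n%:R^-1 => ni S1.
have H1 : (N * B) ^+ 2 <= N * A * (1 - r0).
  apply: le_trans (_ : N ^+ 2 * (F * A) <= _).
    by rewrite exprMn ler_wpM2l ?sqr_ge0.
  rewrite [leLHS](_ : _ = N * A * (N * F)); last by ring.
  by rewrite ler_wpM2l // mulr_ge0 // ltW.
have H2 : r0 * (N * (r0 * gradsq g s)) <= r0 * (N * A).
  by rewrite ler_wpM2l // ler_wpM2l // ltW.
have -> : r0 ^+ 2 * N * gradsq g s = r0 * (N * (r0 * gradsq g s)) by ring.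
have -> : g s ^+ 2 + N * (A + 2 * g s * B) - (g s + N * B) ^+ 2 = N * A - (N * B) ^+ 2.
  by ring.
by move: H1 H2; set X := N * A; lra.
Qed.

End SpinFlipStep.

(** * Commutation of the gradient with one step of the chain *)

Section Contraction.
Context {R : realType} {m n : nat} (f : config n -> 'I_n -> R).
Context (blk : 'I_n -> 'I_m) (b : 'I_m -> 'I_m -> R) (r0 : R).
Implicit Types (s : config n) (v w : 'I_n) (g h : config n -> R).

Hypothesis r0_gt0 : 0 < r0.
Hypothesis nr0 : 1 <= n%:R * r0.
Hypothesis f_range : forall s w, r0 <= f s w <= 1 - r0.
Hypothesis f_flip : forall s w, f (flip s w) w = 1 - f s w.
Hypothesis b_ge0 : forall i j, 0 <= b i j.
Hypothesis f_lip : forall s v w, v != w ->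
  `|f (flip s v) w - f s w| <= b (blk v) (blk w) / n%:R.

Let n_gt0 : (0 < n)%N.
Proof. by rewrite lt0n; apply: contraTneq nr0 => ->; rewrite mul0r ler10. Qed.
Let f01 s w : 0 <= f s w <= 1.
Proof.
have /andP[h1 h2] := f_range s w; rewrite (le_trans (ltW r0_gt0) h1) /=.
by apply: le_trans h2 _; rewrite gerBl ltW.
Qed.
Let f0 s w : 0 <= f s w. Proof. by have /andP[] := f01 s w. Qed.

Local Notation N := (n%:R^-1 : R).
Let N0 : 0 < N. Proof. by rewrite invr_gt0 ltr0n. Qed.
Let nN : n%:R * N = 1. Proof. by rewrite mulfV // pnatr_eq0 -lt0n. Qed.
Let N1 : N <= 1. Proof. by rewrite invf_le1 ?ltr0n // ler1n. Qed.

(** The holding probability less 1/n: this is the mass lost when v itself is updated, since the two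
    copies compared by the gradient at v then agree. [nr0] keeps it nonnegative. *)
Definition lazy_weight s : R := 1 - N - N * \sum_w f s w.

Lemma lazy_weight_ge0 s : 0 <= lazy_weight s.
Proof.
have S1 : N * \sum_w f s w <= 1 - r0.
  rewrite mulrC ler_pdivrMr ?ltr0n //.
  apply: le_trans (_ : \sum_(w < n) (1 - r0) <= _).
    by apply: ler_sum => w _; have /andP[] := f_range s w.
  by rewrite sumr_const card_ord mulr_natr.
have : N <= r0 by rewrite -[N]mulr1 ler_pdivrMl ?ltr0n.
rewrite /lazy_weight; move: S1; lra.
Qed.

(** By [f_flip] an update at v has the same law from s and from [flip s v], whence the lost mass
    1/n. An update at w moves both copies alike, except for the change of the rate at w, which forms
    the last sum. *)
Lemma dflip_stepE v g s : dflip v (step f g) s =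
  (lazy_weight s + N * f s v) * dflip v g s
  + N * (\sum_(w | w != v) f s w * dflip v g (flip s w))
  + N * (\sum_(w | w != v) (f (flip s v) w - f s w) * dflip w g (flip s v)).
Proof.
rewrite {1}/dflip /step.
rewrite [X in _ + _ * X - _ = _](bigD1 v) //= [X in _ - (_ + _ * X)](bigD1 v) //=.
rewrite f_flip dflip_flip /lazy_weight [X in (1 - _ - _ * X + _) * _](bigD1 v) //=.
have -> : \sum_(w | w != v) f (flip s v) w * dflip w g (flip s v) =
  \sum_(w | w != v) f s w * dflip w g s
  + \sum_(w | w != v) f s w * dflip v g (flip s w)
  - (\sum_(w | w != v) f s w) * dflip v g s
  + \sum_(w | w != v) (f (flip s v) w - f s w) * dflip w g (flip s v).
  rewrite mulr_suml -big_split -sumrB -big_split /=.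
  apply: eq_bigr => w _; have := dflip_comm v w g s.
  set A := dflip w g (flip s v); set B := dflip v g (flip s w) => H.
  have -> : B = A - dflip w g s + dflip v g s by rewrite H subrK.
  ring.
have -> : g (flip s v) = g s + dflip v g s by rewrite /dflip; ring.
ring.
Qed.

(** A flip at v only changes the sign of the gradient at v, so the term w = v may be written like
    the others. The weights then sum to [1 - N]. *)
Definition self_part v g s : R :=
  lazy_weight s * `|dflip v g s| + \sum_w N * f s w * `|dflip v g (flip s w)|.

(** The diagonal term w = v is nonnegative and is included to keep the sum uniform. *)
Definition influence_part v g s : R :=
  N * \sum_w b (blk v) (blk w) / n%:R * `|dflip w g (flip s v)|.

Lemma dflip_step_le v g s :
  `|dflip v (step f g) s| <= self_part v g s + influence_part v g s.
Proof.
rewrite dflip_stepE; apply: le_trans (ler_normD _ _) _; apply: lerD.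
  apply: le_trans (ler_normD _ _) _.
  rewrite /self_part [X in _ <= _ + X](bigD1 v) //= dflip_flip normrN addrA -mulrDl.
  rewrite normrM [`|_ + _ * _|]ger0_norm; last first.
    by rewrite addr_ge0 ?lazy_weight_ge0 // mulr_ge0 // ltW.
  rewrite lerD2l normrM gtr0_norm //.
  apply: le_trans (ler_wpM2l (ltW N0) (ler_norm_sum _ _ _)) _.
  rewrite mulr_sumr; apply: ler_sum => w _.
  by rewrite normrM ger0_norm // mulrA.
rewrite normrM gtr0_norm // ler_wpM2l ?(ltW N0) //.
apply: le_trans (ler_norm_sum _ _ _) _.
rewrite [leRHS](bigD1 v) //= ler_wpDl //.
  by rewrite mulr_ge0 // divr_ge0 // b_ge0.
apply: ler_sum => w wv; rewrite normrM ler_wpM2r //.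
by rewrite f_lip // eq_sym.
Qed.

Lemma self_part_ge0 v g s : 0 <= self_part v g s.
Proof.
rewrite addr_ge0 ?mulr_ge0 ?lazy_weight_ge0 //.
by apply: sumr_ge0 => w _; rewrite !mulr_ge0 // ltW.
Qed.

Lemma influence_part_ge0 v g s : 0 <= influence_part v g s.
Proof.
rewrite mulr_ge0 ?(ltW N0) //.
by apply: sumr_ge0 => w _; rewrite !mulr_ge0 ?b_ge0 // ltW.
Qed.

Lemma dflip_step_sqr v g s : dflip v (step f g) s ^+ 2
  <= (self_part v g s + influence_part v g s) ^+ 2.
Proof.
rewrite -[leLHS]real_normK ?num_real // lerXn2r ?nnegrE //.
  by rewrite addr_ge0 ?self_part_ge0 ?influence_part_ge0.
exact: dflip_step_le.
Qed.

Let weights s : lazy_weight s + \sum_w N * f s w = 1 - N.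
Proof. by rewrite /lazy_weight -mulr_sumr subrK. Qed.

(** Jensen for weights of total mass [1 - N]; the remaining factor [1 - N] is half of the
    contraction of squares. *)
Lemma sum_self_part_sqr (P : pred 'I_n) g s :
  \sum_(v | P v) self_part v g s ^+ 2 <=
  (1 - N) * (lazy_weight s * (\sum_(v | P v) dflip v g s ^+ 2) +
    \sum_w N * f s w * \sum_(v | P v) dflip v g (flip s w) ^+ 2).
Proof.
apply: le_trans (_ : \sum_(v | P v) (1 - N) * (lazy_weight s * dflip v g s ^+ 2 +
    \sum_w N * f s w * dflip v g (flip s w) ^+ 2) <= _).
  apply: ler_sum => v _.
  have := @jensen_sqr_lazy R _ predT (lazy_weight s) `|dflip v g s|
    (fun w => N * f s w) (fun w => `|dflip v g (flip s w)|)
    (lazy_weight_ge0 s) (fun w _ => mulr_ge0 (ltW N0) (f0 s w)).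
  rewrite weights real_normK ?num_real //.
  by under [X in _ * (_ + X)]eq_bigr do rewrite real_normK ?num_real //.
rewrite -mulr_sumr big_split /= -mulr_sumr exchange_big /=.
by under [X in _ * (_ + X)]eq_bigr do rewrite -mulr_sumr.
Qed.

(** * Contraction of the blockwise gradient norms with Perron weights *)

Section Blocks.
Variables (p a : 'I_m -> R) (lam : R).
Hypothesis blk_card : forall i, #|[pred v | blk v == i]|%:R = n%:R * p i.
Hypothesis a_ge0 : forall i, 0 <= a i.
Hypothesis b_eigen : forall i, \sum_j b i j * p j * a j = lam * a i.

(** The root mean square of the gradient over block i is at most [c * a i]. Uniformity in the
    configuration makes the bound stable under averaging over neighbouring configurations. *)
Definition block_bounded (c : R) g := forall s i,
  \sum_(v | blk v == i) dflip v g s ^+ 2 <= #|[pred v | blk v == i]|%:R * (c * a i) ^+ 2.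

(** Cauchy-Schwarz in each block turns the mean square bound into a bound on the sum, and the
    eigenvector equation adds up the blocks. *)
Lemma influence_part_le c g s v : 0 <= c -> block_bounded c g ->
  influence_part v g s <= N * (lam * (c * a (blk v))).
Proof.
move=> c0 H; rewrite /influence_part ler_wpM2l ?(ltW N0) //.
rewrite (partition_big blk predT) //=.
have -> : lam * (c * a (blk v)) = \sum_j b (blk v) j / n%:R * (n%:R * p j * (c * a j)).
  rewrite mulrCA -b_eigen mulr_sumr; apply: eq_bigr => j _.
  by rewrite [RHS](_ : _ = n%:R * N * (c * (b (blk v) j * p j * a j))); [rewrite nN mul1r | ring].
apply: ler_sum => j _.
have -> : \sum_(w | blk w == j) b (blk v) (blk w) / n%:R * `|dflip w g (flip s v)| =
   b (blk v) j / n%:R * \sum_(w | blk w == j) `|dflip w g (flip s v)|.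
  by rewrite mulr_sumr; apply: eq_bigr => w /eqP ->.
rewrite ler_wpM2l ?divr_ge0 ?b_ge0 //.
rewrite -blk_card; apply: (@sum_le_of_sqr _ _ [pred w | blk w == j]).
  by rewrite mulr_ge0.
by under eq_bigr do rewrite real_normK ?num_real //; apply: H.
Qed.

(** In root mean square over block i the self part is at most [(1 - N) * (c * a i)], and the
    influence part is pointwise at most [N * lam * (c * a i)]. Minkowski adds the two. *)
Lemma block_bounded_step c g : 0 <= lam -> 0 <= c -> block_bounded c g ->
  block_bounded ((1 - (1 - lam) / n%:R) * c) (step f g).
Proof.
move=> lam0 c0 H s i.
have E2 : \sum_(v | blk v == i) self_part v g s ^+ 2 <=
   #|[pred v | blk v == i]|%:R * ((1 - N) * (c * a i)) ^+ 2.
  apply: le_trans (sum_self_part_sqr _ _ _) _.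
  set M := #|_|%:R.
  have -> : M * ((1 - N) * (c * a i)) ^+ 2 =
      (1 - N) * ((lazy_weight s + \sum_w N * f s w) * (M * (c * a i) ^+ 2)).
    by rewrite weights; ring.
  rewrite ler_wpM2l ?subr_ge0 // [(_ + \sum_w _) * _]mulrDl mulr_suml; apply: lerD.
    by rewrite ler_wpM2l ?lazy_weight_ge0 ?H.
  by apply: ler_sum => w _; rewrite ler_wpM2l ?mulr_ge0 ?(ltW N0) ?H.
have -> : (1 - (1 - lam) / n%:R) * c * a i = (1 - N) * (c * a i) + N * (lam * (c * a i)).
  ring.
apply: le_trans (sum_sqr_shift _ _ E2); last 2 first.
- by rewrite !mulr_ge0 // subr_ge0.
- by rewrite !mulr_ge0 // ltW.
apply: ler_sum => v /eqP vi; apply: le_trans (dflip_step_sqr _ _ _) _.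
rewrite lerXn2r ?nnegrE ?(addr_ge0 (self_part_ge0 v g s)) ?influence_part_ge0 //.
  by rewrite !mulr_ge0 // ltW.
by rewrite lerD2l -vi influence_part_le.
Qed.

Lemma block_bounded_iter t c g : 0 <= lam -> 0 <= c -> block_bounded c g ->
  block_bounded ((1 - (1 - lam) / n%:R) ^+ t * c) (iter t (step f) g).
Proof.
move=> lam0 c0 H; elim: t => [|t IH]; first by rewrite expr0 mul1r.
rewrite exprS -mulrA; apply: block_bounded_step => //.
rewrite mulr_ge0 // exprn_ge0 // mulrBl opprB addrA [1 + _]addrC -addrA mul1r.
by rewrite addr_ge0 ?subr_ge0 // mulr_ge0 // ltW.
Qed.

Lemma block_bounded_gradsq c g s : \sum_i p i = 1 -> (forall i, 0 <= p i) ->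
  (forall i, a i <= 1) -> block_bounded c g -> gradsq g s <= n%:R * c ^+ 2.
Proof.
move=> p1 p0 a1 H; rewrite /gradsq (partition_big blk predT) //=.
have -> : n%:R * c ^+ 2 = \sum_i n%:R * p i * c ^+ 2.
  by rewrite -mulr_suml -mulr_sumr p1 mulr1.
apply: ler_sum => i _.
apply: le_trans (H s i) _; rewrite blk_card ler_wpM2l ?mulr_ge0 //.
by rewrite exprMn ler_piMr ?sqr_ge0 // expr_le1.
Qed.

End Blocks.

(** * Reverse Poincare inequality: smoothing of bounded functions within n steps *)

Section ReversePoincare.
Variable (bmax : R).
Hypothesis b_le : forall i j, b i j <= bmax.

Lemma influence_part_sqr_le g s v : 0 <= bmax ->
  influence_part v g s ^+ 2 <= bmax ^+ 2 * N ^+ 3 * gradsq g (flip s v).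
Proof.
move=> b0.
have H : influence_part v g s <= N * (bmax * N * \sum_w `|dflip w g (flip s v)|).
  rewrite ler_wpM2l ?(ltW N0) // mulr_sumr; apply: ler_sum => w _.
  by rewrite ler_wpM2r // ler_wpM2r ?(ltW N0).
apply: le_trans (_ : (N * (bmax * N * \sum_w `|dflip w g (flip s v)|)) ^+ 2 <= _).
  rewrite lerXn2r ?nnegrE ?influence_part_ge0 //.
  by rewrite !mulr_ge0 ?sumr_ge0 // ltW.
have := @sqr_sum_card R _ predT (fun w : 'I_n => `|dflip w g (flip s v)|).
under [X in _ <= _ * X]eq_bigr do rewrite real_normK ?num_real //.
rewrite card_ord -/(gradsq g (flip s v)).
set S := \sum_w _; set G := gradsq _ _ => J.
have -> : bmax ^+ 2 * N ^+ 3 * G = (N ^+ 2 * bmax ^+ 2 * N ^+ 2) * (n%:R * G).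
  by rewrite [RHS](_ : _ = n%:R * N * (bmax ^+ 2 * N ^+ 3 * G)); [rewrite nN mul1r | ring].
have -> : (N * (bmax * N * S)) ^+ 2 = (N ^+ 2 * bmax ^+ 2 * N ^+ 2) * S ^+ 2 by ring.
by rewrite ler_wpM2l // !mulr_ge0 ?sqr_ge0.
Qed.

Let C := 1 + 2 * bmax ^+ 2 / r0.

(** The squared gradient grows by at most a factor [1 + C / n] relative to its expected value after
    one step. The influence at v is measured at [flip s v], a configuration reached with probability
    at least [r0 / n], so it is controlled by the same expectation. *)
Lemma gradsq_step_le g s : 0 <= bmax ->
  gradsq (step f g) s <= (1 + C * N) * step f (gradsq g) s.
Proof.
move=> b0.
have E2 : \sum_v self_part v g s ^+ 2 <= step f (gradsq g) s.
  apply: le_trans (sum_self_part_sqr predT _ _) _.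
  apply: le_trans (_ : lazy_weight s * gradsq g s + N * (\sum_w f s w * gradsq g (flip s w)) <= _).
    apply: le_trans (ler_piMl _ _) _.
    - rewrite addr_ge0 ?mulr_ge0 ?lazy_weight_ge0 ?gradsq_ge0 //.
      by apply: sumr_ge0 => w _; rewrite !mulr_ge0 ?gradsq_ge0 // ltW.
    - by rewrite gerBl ltW.
    - rewrite lerD2l mulr_sumr; apply: ler_sum => w _.
      by rewrite mulrA.
  rewrite stepE lerD2r ler_wpM2r ?gradsq_ge0 // /lazy_weight.
  by rewrite lerD2r gerBl ltW.
have F2 : \sum_v influence_part v g s ^+ 2 <= bmax ^+ 2 / r0 * N ^+ 2 * step f (gradsq g) s.
  apply: le_trans (_ : \sum_v bmax ^+ 2 / r0 * N ^+ 2 * (N * (f s v * gradsq g (flip s v))) <= _).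
    apply: ler_sum => v _; apply: le_trans (influence_part_sqr_le _ _ _ b0) _.
    set G := gradsq _ _.
    rewrite [leRHS](_ : _ = bmax ^+ 2 * N ^+ 3 * ((f s v / r0) * G)); last by ring.
    rewrite ler_wpM2l ?mulr_ge0 ?sqr_ge0 ?exprn_ge0 ?(ltW N0) //.
    rewrite ler_peMl ?gradsq_ge0 // ler_pdivlMr // mul1r.
    by have /andP[] := f_range s v.
  rewrite -mulr_sumr ler_wpM2l ?mulr_ge0 ?invr_ge0 ?sqr_ge0 ?(ltW r0_gt0) //.
  rewrite -mulr_sumr; apply: step_ge_flips => //.
  by move=> u; apply: gradsq_ge0.
have S0 : 0 <= step f (gradsq g) s.
  by apply: le_trans E2; apply: sumr_ge0 => v _; apply: sqr_ge0.
(* Young's inequality [(x + y)^2 <= (1 + 1/n) x^2 + (1 + n) y^2]: the large factor falls on the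
   influence part, whose total square is of order [1/n^2]. *)
apply: le_trans (_ : (1 + N) * (\sum_v self_part v g s ^+ 2) +
   (1 + n%:R) * (\sum_v influence_part v g s ^+ 2) <= _).
  rewrite !mulr_sumr -big_split /=; apply: ler_sum => v _.
  apply: le_trans (dflip_step_sqr _ _ _) _.
  set x := self_part _ _ _; set y := influence_part _ _ _.
  rewrite -subr_ge0 [X in 0 <= X](_ : _ = N * (x - n%:R * y) ^+ 2).
    by rewrite mulr_ge0 ?sqr_ge0 // ltW.
  rewrite [RHS](_ : _ = N * x ^+ 2 - 2 * x * y * (n%:R * N) + n%:R * y ^+ 2 * (n%:R * N)); last by ring.
  by rewrite nN; ring.
apply: le_trans (lerD (ler_wpM2l _ E2) (ler_wpM2l _ F2)) _.
- by rewrite addr_ge0 // ltW.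
- by rewrite addr_ge0.
rewrite mulrA -mulrDl ler_wpM2r //.
have -> : (1 + n%:R) * (bmax ^+ 2 / r0 * N ^+ 2) = bmax ^+ 2 / r0 * N * (N + n%:R * N) by ring.
rewrite nN /C.
have K0 : 0 <= bmax ^+ 2 / r0 by rewrite divr_ge0 ?sqr_ge0 // ltW.
rewrite -[2 * _ / _]mulrA; have N1' : 0 <= 1 - N by rewrite subr_ge0.
have := mulr_ge0 (mulr_ge0 K0 (ltW N0)) N1'.
set K := bmax ^+ 2 / r0; set M := N; lra.
Qed.

Lemma gradsq_iter_le j g s : 0 <= bmax ->
  gradsq (iter j (step f) g) s <= (1 + C * N) ^+ j * iter j (step f) (gradsq g) s.
Proof.
move=> b0; have C0 : 0 <= 1 + C * N.
  by rewrite addr_ge0 // mulr_ge0 ?(ltW N0) // addr_ge0 // !mulr_ge0 ?sqr_ge0 // invr_ge0 ltW.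
elim: j s => [|j IH] s; first by rewrite expr0 mul1r.
rewrite /=; apply: le_trans (gradsq_step_le _ _ b0) _.
rewrite exprS -mulrA ler_wpM2l // -stepZ.
by apply: le_step.
Qed.

(** The variance of g after n steps is at most one. It is a sum of n one-step variances, each at
    least [r0 ^+ 2 / n] times an averaged squared gradient of [P^i g], hence at least
    [r0 ^+ 2 / n * expR (- C)] times the squared gradient of [P^(n-1) g]. The index [n.-1] is the
    last one of the decomposition. *)
Lemma gradsq_iter_bounded g s : 0 <= bmax -> (forall u, `|g u| <= 1) ->
  gradsq (iter n.-1 (step f) g) s <= expR C / r0 ^+ 2.
Proof.
move=> b0 g1.
have C0 : 0 <= C by rewrite addr_ge0 // !mulr_ge0 ?sqr_ge0 // invr_ge0 ltW.
set G := gradsq _ s.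
have r2 : 0 < r0 ^+ 2 by rewrite exprn_gt0.
rewrite ler_pdivlMr // -[expR C]mulr1 -ler_pdivrMl ?expR_gt0 // -expRN.
have := iter_step_variance f n g s; set V := (X in X = _) => HV.
have V1 : V <= 1.
  rewrite /V lerBlDr; apply: le_trans (_ : 1 <= _); last by rewrite lerDl sqr_ge0.
  rewrite -[leRHS](iter_step_cst f n 1 s); apply: le_iter_step => // u.
  by rewrite -[leLHS]real_normK ?num_real // expr_le1.
apply: le_trans V1; rewrite HV.
apply: le_trans (_ : \sum_(i < n) r0 ^+ 2 * N * (expR (- C) * G) <= _).
  rewrite sumr_const card_ord -[leRHS]mulr_natl.
  rewrite [leRHS](_ : _ = n%:R * N * (expR (- C) * (G * r0 ^+ 2))); last by ring.
  by rewrite nN mul1r.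
apply: ler_sum => i _.
apply: le_trans (_ : iter (n.-1 - i) (step f)
   (fun u => r0 ^+ 2 * N * gradsq (iter i (step f) g) u) s <= _); last first.
  by apply: le_iter_step => // u; apply: step_variance_ge => //; apply: ltW.
rewrite iter_stepZ ler_wpM2l ?mulr_ge0 ?(ltW N0) ?(ltW r0_gt0) //.
rewrite expRN ler_pdivrMl ?expR_gt0 //.
have := gradsq_iter_le (n.-1 - i) (iter i (step f) g) s b0.
rewrite -iterD subnK; last by have := ltn_ord i; lia.
rewrite -/G => H; apply: le_trans H _; rewrite ler_wpM2r //.
  rewrite -[leLHS](iter_step_cst f (n.-1 - i) 0 s); apply: le_iter_step => // u.
  exact: gradsq_ge0.
(* At most n factors [1 + C / n] occur, so their product is at most [expR C]. *)
apply: le_trans (_ : expR (C * N) ^+ (n.-1 - i) <= _).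
  by rewrite lerXn2r ?nnegrE ?expR_ge0 ?expR_ge1Dx // addr_ge0 // mulr_ge0 // ltW.
rewrite -expRM_natl ler_expR mulrCA ler_piMr //.
rewrite ler_pdivrMr ?ltr0n // mul1r ler_nat; lia.
Qed.

End ReversePoincare.

End Contraction.

(** * Total variation: upper bound by duality, lower bound by moments *)

Section TotalVariation.
Context {R : realType} {n : nat}.
Implicit Types (mu nu g : config n -> R).

(** The sign of [mu - nu] is the extremal test function. *)
Lemma tvdist_le_oscillation mu nu (D : R) :
  (forall g, (forall u, `|g u| <= 1) -> \sum_u mu u * g u - \sum_u nu u * g u <= D) ->
  tvdist mu nu <= D / 2.
Proof.
move=> H; rewrite /tvdist mulrC ler_wpM2r ?invr_ge0 //.
apply: le_trans (H (fun u => Num.sg (mu u - nu u)) _); last first.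
  by move=> u; rewrite normr_sg; case: (_ != _).
rewrite -sumrB.
by apply: ler_sum => u _; rewrite -mulrBl mulrC -normrEsg.
Qed.

Lemma tvdist_le1 mu nu : (forall u, 0 <= mu u) -> (forall u, 0 <= nu u) ->
  \sum_u mu u = 1 -> \sum_u nu u = 1 -> tvdist mu nu <= 1.
Proof.
move=> mu0 nu0 mu1 nu1; rewrite /tvdist ler_pdivrMl // mulr1.
apply: le_trans (_ : \sum_u (mu u + nu u) <= _).
  apply: ler_sum => u _; apply: le_trans (ler_normB _ _) _.
  by rewrite !ger0_norm.
by rewrite big_split /= mu1 nu1.
Qed.

(** The event [g > M / 2] separates the measures: Chebyshev's inequality around the mean M makes it
    likely under [mu], Markov's inequality for the square makes it unlikely under [nu]. *)
Lemma tvdist_ge_moments mu nu g (M V W : R) :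
  (forall u, 0 <= mu u) -> (forall u, 0 <= nu u) ->
  \sum_u mu u = 1 -> \sum_u nu u = 1 -> 0 < M ->
  \sum_u mu u * g u = M ->
  \sum_u mu u * g u ^+ 2 - M ^+ 2 <= V -> \sum_u nu u * g u ^+ 2 <= W ->
  1 - 4 * (V + W) / M ^+ 2 <= tvdist mu nu.
Proof.
move=> mu0 nu0 mu1 nu1 M0 gM gV gW.
have M2 : 0 < M ^+ 2 by rewrite exprn_gt0.
pose A u := M / 2 < g u.
have T : \sum_u mu u * (A u)%:R - \sum_u nu u * (A u)%:R <= tvdist mu nu.
  rewrite /tvdist ler_pdivlMl // -sumrB.
  (* The indicator of A is half of one plus a sign, and the constant cancels because both measures
     have mass one. *)
  have -> : \sum_u (mu u * (A u)%:R - nu u * (A u)%:R) =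
    2^-1 * \sum_u (mu u - nu u) * (if A u then 1 else -1).
    have E u : mu u * (A u)%:R - nu u * (A u)%:R =
       2^-1 * ((mu u - nu u) * (if A u then 1 else -1)) + 2^-1 * (mu u - nu u).
      by case: (A u) => /=; field.
    under eq_bigr do rewrite E.
    by rewrite big_split /= -!mulr_sumr sumrB mu1 nu1 subrr mulr0 addr0.
  rewrite mulrA divff // mul1r; apply: ler_sum => u _.
  apply: le_trans (ler_norm _) _; rewrite normrM.
  by case: (A u); rewrite ?normrN normr1 mulr1.
apply: le_trans T.
have M4 : M ^+ 2 = 4 * (M / 2) ^+ 2 by field.
have H1 : \sum_u nu u * (A u)%:R <= 4 * W / M ^+ 2.
  rewrite ler_pdivlMr // mulr_suml; apply: le_trans (ler_wpM2l _ gW) => //.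
  rewrite mulr_sumr; apply: ler_sum => u _.
  rewrite -mulrA [leRHS]mulrCA ler_wpM2l //.
  rewrite /A; case: ltP => [H|_]; last by rewrite mul0r mulr_ge0 ?sqr_ge0.
  by rewrite mul1r M4 ler_wpM2l // lerXn2r ?nnegrE ?divr_ge0 ?(ltW M0) ?(ltW H) // ltW // (lt_trans _ H) // divr_gt0.
have H2 : 1 - \sum_u mu u * (A u)%:R <= 4 * V / M ^+ 2.
  rewrite -{1}mu1 -sumrB ler_pdivlMr // mulr_suml.
  apply: le_trans (ler_wpM2l _ gV) => //.
  have -> : \sum_u mu u * g u ^+ 2 - M ^+ 2 = \sum_u mu u * (g u - M) ^+ 2.
    have E u : mu u * (g u - M) ^+ 2 = mu u * g u ^+ 2 - 2 * M * (mu u * g u) + M ^+ 2 * mu u by ring.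
    under [RHS]eq_bigr do rewrite E.
    by rewrite big_split /= sumrB -!mulr_sumr gM mu1; ring.
  rewrite mulr_sumr; apply: ler_sum => u _.
  rewrite -[X in X - _]mulr1 -mulrBr -mulrA [leRHS]mulrCA ler_wpM2l //.
  rewrite /A; case: ltP => [_|H]; first by rewrite subrr mul0r mulr_ge0 ?sqr_ge0.
  by rewrite subr0 mul1r; nra.
by rewrite mulrDr mulrDl; move: H1 H2; lra.
Qed.

End TotalVariation.

(** * The Glauber dynamics as a flip chain, and its reversibility *)

Section Glauber.
Context {R : realType} {m n : nat} (k : 'M[R]_m) (beta : R) (blk : 'I_n -> 'I_m).
Implicit Types (s u : config n) (v w : 'I_n) (g : config n -> R).

Local Notation S := (locfield k blk).
Local Notation rt := (rate beta).
Local Notation pi := (gibbs k beta blk).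

(** The probability that an update at w changes the spin there. *)
Definition flip_rate s w : R := rt (S s w) (~~ s w).

Hypothesis n_gt0 : (0 < n)%N.

Lemma spinN b : spin R (~~ b) = - spin R b.
Proof. by case: b; rewrite /= ?opprK. Qed.

Lemma spin_sqr b : spin R b * spin R b = 1.
Proof. by case: b; rewrite /spin ?mulrNN mulr1. Qed.

Lemma norm_spin b : `|spin R b| = 1.
Proof. by case: b; rewrite /spin ?normrN normr1. Qed.

Lemma rateN (x : R) b : rt x (~~ b) = 1 - rt x b.
Proof. by rewrite /rate spinN; field. Qed.

Lemma flip_rateE s w : flip_rate s w = (1 - spin R (s w) * tanhR (beta * S s w)) / 2.
Proof. by rewrite /flip_rate /rate spinN mulNr. Qed.

(** An update at v reaches only s and [flip s v], so the inner sum over targets has two nonzero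
    terms. *)
Lemma sum_glauber s g : \sum_(u : config n) glauber k beta blk s u * g u = step flip_rate g s.
Proof.
have H v : \sum_(u : config n) (if [forall w, (w != v) ==> (u w == s w)] then rt (S s v) (u v) else 0) * g u
   = g s + flip_rate s v * dflip v g s.
  have sf : flip s v != s.
    by apply/eqP => /ffunP/(_ v); rewrite flipE eqxx; case: (s v).
  rewrite (bigD1 s) //= (bigD1 (flip s v)) //= big1 ?addr0; last first.
    move=> u /andP[us uf]; case: ifP => [/forallP H|]; last by rewrite mul0r.
    case/eqP: us.
    case: (eqVneq (u v) (s v)) => E.
      apply/ffunP => w; case: (eqVneq w v) => [->//|wv].
      by have := H w; rewrite wv => /eqP.
    case/eqP: uf; apply/ffunP => w; rewrite flipE; case: (eqVneq w v) => [->|wv].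
      by move: E; case: (u v); case: (s v).
    by have := H w; rewrite wv => /eqP.
  have -> : [forall w, (w != v) ==> (s w == s w)].
    by apply/forallP => w; rewrite eqxx implybT.
  have -> : [forall w, (w != v) ==> (flip s v w == s w)].
    by apply/forallP => w; apply/implyP => wv; rewrite flipE (negbTE wv).
  by rewrite flipE eqxx /dflip /flip_rate rateN; ring.
rewrite /step /glauber.
have -> : \sum_(u : config n) n%:R^-1 * (\sum_v (if [forall w, (w != v) ==> (u w == s w)]
    then rt (S s v) (u v) else 0)) * g u =
  n%:R^-1 * \sum_v (g s + flip_rate s v * dflip v g s).
  under [in RHS]eq_bigr do rewrite -H.
  rewrite exchange_big mulr_sumr /=; apply: eq_bigr => u _.
  by rewrite -mulrA mulr_suml.
rewrite big_split /= mulrDr sumr_const card_ord -[g s *+ n]mulr_natl mulrA.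
by rewrite mulVf ?mul1r // pnatr_eq0 -lt0n.
Qed.

Lemma sum_Pt t s g :
  \sum_(u : config n) Pt k beta blk t s u * g u = iter t (step flip_rate) g s.
Proof.
elim: t g => [|t IH] g /=.
  rewrite (bigD1 s) //= eqxx mul1r big1 ?addr0 // => u us.
  by rewrite eq_sym (negbTE us) mul0r.
under eq_bigr do rewrite mulr_suml.
rewrite exchange_big /= -iterS iterSr -IH; apply: eq_bigr => r _.
rewrite -sum_glauber mulr_sumr; apply: eq_bigr => u _.
by rewrite mulrA.
Qed.

Lemma rate_ge0 (x : R) b : 0 <= rt x b.
Proof.
rewrite /rate divr_ge0 // -lerBlDl sub0r.
have := tanhR_lt1 (beta * x); have := tanhR_gtN1 (beta * x).
by case: b; rewrite /spin ?mul1r ?mulN1r; lra.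
Qed.

Lemma Pt_ge0 t s u : 0 <= Pt k beta blk t s u.
Proof.
elim: t u => [|t IH] u /=; first by rewrite ler0n.
apply: sumr_ge0 => r _; rewrite mulr_ge0 // mulr_ge0 ?invr_ge0 ?ler0n //.
by apply: sumr_ge0 => v _; case: ifP => // _; apply: rate_ge0.
Qed.

Lemma sum_Pt1 t s : \sum_(u : config n) Pt k beta blk t s u = 1.
Proof.
have := sum_Pt t s (fun=> 1); rewrite iter_step_cst => <-.
by apply: eq_bigr => u _; rewrite mulr1.
Qed.

Lemma locfield_flip s v : S (flip s v) v = S s v.
Proof.
by apply: eq_bigr => w wv; rewrite flipE (negbTE wv).
Qed.

Lemma locfield_flip_neq s v w : v != w ->
  S (flip s v) w - S s w = - 2 * Kint k blk w v * spin R (s v).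
Proof.
move=> vw; rewrite /locfield (bigD1 v) //= [X in _ - X](bigD1 v) //=.
rewrite flipE eqxx spinN.
under eq_bigr => x /andP[_ xv] do rewrite flipE (negbTE xv).
ring.
Qed.

Lemma flip_rate_flip s w : flip_rate (flip s w) w = 1 - flip_rate s w.
Proof. by rewrite /flip_rate locfield_flip flipE eqxx rateN. Qed.

Hypothesis k_sym : forall i j, k i j = k j i.
Hypothesis k_ge0 : forall i j, 0 <= k i j.
Hypothesis beta_ge0 : 0 <= beta.

Lemma Kint_ge0 v w : 0 <= Kint k blk v w.
Proof. by rewrite /Kint divr_ge0. Qed.

(** [tanh] is 1-Lipschitz, and the factor 2 by which a spin changes cancels the 1/2 in the rate. *)
Lemma flip_rate_lip s v w : v != w ->
  `|flip_rate (flip s v) w - flip_rate s w| <= beta * k (blk v) (blk w) / n%:R.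
Proof.
move=> vw; rewrite !flip_rateE flipE eq_sym (negbTE vw).
have -> : (1 - spin R (s w) * tanhR (beta * S (flip s v) w)) / 2 -
   (1 - spin R (s w) * tanhR (beta * S s w)) / 2 =
   - spin R (s w) * ((tanhR (beta * S (flip s v) w) - tanhR (beta * S s w)) / 2).
  by field.
rewrite normrM normrN norm_spin mul1r normrM [`|2^-1|]ger0_norm // ler_pdivrMr //.
apply: le_trans (tanhR_lip _ _) _; rewrite -mulrBr locfield_flip_neq //.
rewrite !normrM normrN norm_spin mulr1 !ger0_norm ?Kint_ge0 // /Kint k_sym.
by rewrite le_eqVlt; apply/orP; left; apply/eqP; ring.
Qed.

Lemma flip_rate_range kmax : (forall i j, k i j <= kmax) -> forall s w,
  (1 - tanhR (beta * kmax)) / 2 <= flip_rate s w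
     <= 1 - (1 - tanhR (beta * kmax)) / 2.
Proof.
move=> kM s w.
have kM0 : 0 <= kmax by apply: le_trans (k_ge0 (blk w) (blk w)) (kM _ _).
have SM : `|S s w| <= kmax.
  apply: le_trans (ler_norm_sum _ _ _) _.
  apply: le_trans (_ : \sum_(v < n) kmax / n%:R <= _).
    rewrite [leRHS](bigID (fun v => v != w)) /= ler_wpDr //.
      by apply: sumr_ge0 => v _; rewrite divr_ge0.
    apply: ler_sum => v _; rewrite normrM norm_spin mulr1 ger0_norm ?Kint_ge0 //.
    by rewrite ler_wpM2r ?invr_ge0.
  rewrite sumr_const card_ord -[leLHS]mulr_natr mulfVK // pnatr_eq0 -lt0n //.
move: SM; rewrite ler_norml => /andP[S1 S2].
have T1 : tanhR (beta * S s w) <= tanhR (beta * kmax) by rewrite ler_tanhR // ler_wpM2l.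
have T2 : - tanhR (beta * kmax) <= tanhR (beta * S s w).
  by rewrite -tanhRN ler_tanhR // -mulrN ler_wpM2l.
rewrite flip_rateE; move: T1 T2.
by case: (s w); rewrite /spin ?mul1r ?mulN1r; lra.
Qed.

Lemma sum_hamil s : 2 * hamil k blk s =
  \sum_v \sum_(w | w != v) Kint k blk v w * spin R (s v) * spin R (s w).
Proof.
have -> : 2 * hamil k blk s = hamil k blk s + hamil k blk s by ring.
rewrite {2}/hamil; rewrite (exchange_big_dep predT) //= -big_split /=.
apply: eq_bigr => v _.
rewrite [RHS](bigID (fun w => (v < w)%N)) /=; congr (_ + _).
  by apply: eq_bigl => w /=; case: (eqVneq w v) => [->|]; rewrite ?ltnn.
rewrite [RHS](eq_bigl (fun w : 'I_n => (w < v)%N)); last first.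
  by move=> w /=; case: (eqVneq w v) => [->|]; rewrite ?ltnn // -val_eqE /=; lia.
by apply: eq_bigr => w _; rewrite /Kint k_sym; ring.
Qed.

Lemma hamil_flip s w : hamil k blk (flip s w) = hamil k blk s - 2 * spin R (s w) * S s w.
Proof.
suff : 2 * hamil k blk (flip s w) = 2 * hamil k blk s - 4 * spin R (s w) * S s w.
  by move=> H; apply: (@mulfI _ 2); rewrite ?pnatr_eq0 // H; ring.
(* Twice the energy is split into the row and the column of w, equal by symmetry, and a rest that
   the flip at w does not touch. *)
have row u : 2 * hamil k blk u = spin R (u w) * S u w * 2 +
  \sum_(v | v != w) \sum_(x | (x != v) && (x != w)) Kint k blk v x * spin R (u v) * spin R (u x).
  rewrite sum_hamil (bigD1 w) //=.
  have -> : \sum_(v | v != w) \sum_(x | x != v) Kint k blk v x * spin R (u v) * spin R (u x)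
   = \sum_(v | v != w) Kint k blk w v * spin R (u v) * spin R (u w) +
     \sum_(v | v != w) \sum_(x | (x != v) && (x != w)) Kint k blk v x * spin R (u v) * spin R (u x).
    rewrite -big_split /=; apply: eq_bigr => v vw.
    by rewrite (bigD1 w) 1?eq_sym //= /Kint k_sym.
  rewrite addrA; congr (_ + _).
  have E1 : \sum_(v | v != w) Kint k blk w v * spin R (u v) * spin R (u w) = spin R (u w) * S u w.
    by rewrite /locfield mulr_sumr; apply: eq_bigr => v _; ring.
  have E2 : \sum_(x | x != w) Kint k blk w x * spin R (u w) * spin R (u x) = spin R (u w) * S u w.
    by rewrite /locfield mulr_sumr; apply: eq_bigr => v _; ring.
  by rewrite E1 E2; ring.
rewrite !row locfield_flip flipE eqxx spinN.
have -> : \sum_(v | v != w) \sum_(x | (x != v) && (x != w))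
     Kint k blk v x * spin R (flip s w v) * spin R (flip s w x) =
   \sum_(v | v != w) \sum_(x | (x != v) && (x != w)) Kint k blk v x * spin R (s v) * spin R (s x).
  apply: eq_bigr => v vw; apply: eq_bigr => x /andP[_ xw].
  by rewrite !flipE (negbTE vw) (negbTE xw).
ring.
Qed.

(** The factor is [2 cosh (beta S)], which does not depend on the spin at w and so cancels in
    detailed balance. *)
Lemma flip_rate_expR s w : flip_rate s w * (expR (beta * S s w) + expR (- (beta * S s w)))
  = expR (- (beta * spin R (s w) * S s w)).
Proof.
rewrite flip_rateE /tanhR; set x := beta * S s w.
have P : expR x + expR (- x) != 0 by rewrite gt_eqF // addr_gt0 ?expR_gt0.
case: (s w); rewrite /spin ?mulr1 ?mulrN1 ?mulNr ?opprK -/x; by field.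
Qed.

Lemma detailed_balance s w : pi (flip s w) * flip_rate (flip s w) w = pi s * flip_rate s w.
Proof.
rewrite /gibbs [LHS]mulrAC [RHS]mulrAC; congr (_ / _).
pose Z := expR (beta * S s w) + expR (- (beta * S s w)).
have P : Z != 0 by rewrite gt_eqF // addr_gt0 ?expR_gt0.
apply: (mulIf P); rewrite -[LHS]mulrA -[RHS]mulrA.
have := flip_rate_expR (flip s w) w; rewrite locfield_flip -/Z => ->.
rewrite flip_rate_expR -!expRD hamil_flip flipE eqxx spinN; congr expR.
ring.
Qed.

Lemma gibbs_ge0 s : 0 <= pi s.
Proof.
by rewrite /gibbs divr_ge0 ?expR_ge0 // sumr_ge0 // => t _; apply: expR_ge0.
Qed.

Lemma sum_gibbs : \sum_(s : config n) pi s = 1.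
Proof.
rewrite /gibbs -mulr_suml divff // gt_eqF // (bigD1 [ffun=> true]) //=.
by rewrite ltr_wpDr ?expR_gt0 // sumr_ge0 // => t _; apply: expR_ge0.
Qed.

(** For each site w, detailed balance and the involution [flip] at w make the two halves of the
    drift cancel. *)
Lemma gibbs_stationary g : \sum_s pi s * step flip_rate g s = \sum_s pi s * g s.
Proof.
rewrite /step.
have -> : \sum_s pi s * (g s + n%:R^-1 * \sum_w flip_rate s w * dflip w g s) =
  \sum_s pi s * g s + n%:R^-1 * \sum_w \sum_s pi s * flip_rate s w * dflip w g s.
  rewrite exchange_big mulr_sumr -big_split /=; apply: eq_bigr => s _.
  rewrite mulrDr mulrCA mulr_sumr; congr (_ + _ * _).
  by apply: eq_bigr => w _; rewrite mulrA.
rewrite [X in _ + _ * X]big1 ?mulr0 ?addr0 // => w _.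
have -> : \sum_s pi s * flip_rate s w * dflip w g s =
  \sum_s pi s * flip_rate s w * g (flip s w) - \sum_s pi s * flip_rate s w * g s.
  by rewrite -sumrB; apply: eq_bigr => s _; rewrite -mulrBr.
apply/eqP; rewrite subr_eq0; apply/eqP.
rewrite [RHS](reindex_inj (inv_inj (flipK w))) /=.
by apply: eq_bigr => s _; rewrite detailed_balance.
Qed.

Lemma gibbs_stationary_iter t g :
  \sum_s pi s * iter t (step flip_rate) g s = \sum_s pi s * g s.
Proof. by elim: t => //= t IH; rewrite gibbs_stationary. Qed.

Lemma dist_n_ge0 t : 0 <= dist_n k beta blk t.
Proof.
rewrite /dist_n; elim/big_ind: _ => // [x y x0 y0|s _].
  by rewrite le_max x0.
by rewrite /tvdist mulr_ge0 ?invr_ge0 // sumr_ge0.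
Qed.

Lemma dist_n_le1 t : dist_n k beta blk t <= 1.
Proof.
rewrite /dist_n; apply: bigmax_le => // s _.
apply: tvdist_le1; [exact: Pt_ge0|exact: gibbs_ge0|exact: sum_Pt1|exact: sum_gibbs].
Qed.

(** By stationarity the equilibrium mean of g is the mean of [P^t g], so the difference of means is
    an average of differences of [P^t g]. *)
Lemma dist_n_le_oscillation t (D : R) : 0 <= D ->
  (forall g, (forall u, `|g u| <= 1) -> forall s u,
     iter t (step flip_rate) g s - iter t (step flip_rate) g u <= D) ->
  dist_n k beta blk t <= D / 2.
Proof.
move=> D0 H; rewrite /dist_n; apply: bigmax_le; first by rewrite divr_ge0.
move=> s _; apply: tvdist_le_oscillation => g g1.
rewrite sum_Pt -(gibbs_stationary_iter t) -[X in X - _]mulr1 -sum_gibbs mulr_sumr -sumrB.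
apply: le_trans (_ : \sum_u pi u * D <= _).
  apply: ler_sum => u _; rewrite [_ * pi u]mulrC -mulrBr ler_wpM2l ?gibbs_ge0 //.
  exact: H.
by rewrite -mulr_suml sum_gibbs mul1r.
Qed.

Lemma dist_n_ge_moments t s g (V W : R) : 0 < iter t (step flip_rate) g s ->
  iter t (step flip_rate) (fun u => g u ^+ 2) s - iter t (step flip_rate) g s ^+ 2 <= V ->
  \sum_u pi u * g u ^+ 2 <= W ->
  1 - 4 * (V + W) / iter t (step flip_rate) g s ^+ 2 <= dist_n k beta blk t.
Proof.
move=> M0 HV HW; apply: le_trans (_ : tvdist (Pt k beta blk t s) pi <= _); last first.
  exact: le_bigmax.
apply: (@tvdist_ge_moments _ _ _ _ g) => //.
- exact: Pt_ge0.
- exact: gibbs_ge0.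
- exact: sum_Pt1.
- exact: sum_gibbs.
- exact: sum_Pt.
- by rewrite sum_Pt.
Qed.

End Glauber.

Lemma sum_geometric_le {R : realFieldType} (q : R) t : 0 <= q -> q < 1 ->
  \sum_(i < t) q ^+ i <= (1 - q)^-1.
Proof.
move=> q0 q1; rewrite -[leRHS]mul1r ler_pdivlMr ?subr_gt0 // mulrC.
have -> : (1 - q) * \sum_(i < t) q ^+ i = 1 - q ^+ t.
  by rewrite -opprB mulNr -subrX1 opprB.
by rewrite gerBl exprn_ge0.
Qed.

Lemma subset_with_card {T : finType} (P : {pred T}) h : (h <= #|P|)%N ->
  exists2 B : {set T}, {subset B <= P} & #|B| = h.
Proof.
move=> hP; exists [set x in take h (enum P)].
  by move=> x; rewrite inE => /mem_take; rewrite mem_enum.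
rewrite cardsE (card_uniqP _) ?take_uniq ?enum_uniq // size_take -cardE.
by case: ltnP hP => // h1 h2; apply/eqP; rewrite eqn_leq h1 h2.
Qed.

(** * The block model for a fixed n: upper bound on the distance *)

Section Model.
Context {R : realType} {m n : nat} (p a : 'I_m -> R) (k : 'M[R]_m) (beta lam : R).
Context (blk : 'I_n -> 'I_m).
Implicit Types (s u : config n) (v w : 'I_n) (i j : 'I_m).

Hypothesis p_gt0 : forall i, 0 < p i.
Hypothesis p_sum : \sum_i p i = 1.
Hypothesis a_gt0 : forall i, 0 < a i.
Hypothesis a_sum : \sum_i a i = 1.
Hypothesis k_sym : forall i j, k i j = k j i.
Hypothesis k_ge0 : forall i j, 0 <= k i j.
Hypothesis beta_ge0 : 0 <= beta.
Hypothesis lam_ge0 : 0 <= lam.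
Hypothesis lam_lt1 : lam < 1.
Hypothesis eigen : forall i, \sum_j beta * k i j * p j * a j = lam * a i.
Hypothesis n_gt0 : (0 < n)%N.
Hypothesis blk_card : forall i, #|[pred v | blk v == i]|%:R = n%:R * p i.

Local Notation N := (n%:R^-1 : R).
Local Notation q := (1 - (1 - lam) / n%:R : R).
Local Notation S := (locfield k blk).
Local Notation P := (step (flip_rate k beta blk)).

(** The sum of all entries serves as a bound on each of them. *)
Definition kmax : R := \sum_i \sum_j k i j.

Lemma k_le_max i j : k i j <= kmax.
Proof.
rewrite /kmax (bigD1 i) //= (bigD1 j) //= -addrA lerDl addr_ge0 //.
  by rewrite sumr_ge0.
by rewrite sumr_ge0 // => ? _; rewrite sumr_ge0.
Qed.

Lemma kmax_ge0 : 0 <= kmax.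
Proof. by rewrite /kmax sumr_ge0 // => ? _; rewrite sumr_ge0. Qed.

Definition min_rate : R := (1 - tanhR (beta * kmax)) / 2.

Lemma min_rate_gt0 : 0 < min_rate.
Proof. by rewrite /min_rate divr_gt0 // subr_gt0 tanhR_lt1. Qed.

(** The constant of the reverse Poincare inequality for influence [beta * kmax] and minimal rate
    [min_rate]. *)
Definition grad_const : R :=
  expR (1 + 2 * (beta * kmax) ^+ 2 / min_rate) / min_rate ^+ 2.

Let N0 : 0 < N. Proof. by rewrite invr_gt0 ltr0n. Qed.
Let nN : n%:R * N = 1. Proof. by rewrite mulfV // pnatr_eq0 -lt0n. Qed.
Let N1 : N <= 1. Proof. by rewrite invf_le1 ?ltr0n // ler1n. Qed.
Let q0 : 0 <= q.
Proof.
rewrite subr_ge0; apply: le_trans N1; rewrite ler_piMl ?(ltW N0) //.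
by rewrite gerBl.
Qed.
Let a1 i : a i <= 1.
Proof.
by rewrite -a_sum (bigD1 i) //= lerDl sumr_ge0 // => j _; apply: ltW.
Qed.
Let p1 i : p i <= 1.
Proof.
by rewrite -p_sum (bigD1 i) //= lerDl sumr_ge0 // => j _; apply: ltW.
Qed.

(** The [n.-1] steps applied first to g bound its gradient, the other t steps contract it by
    [q ^+ t], and [path_bound] contributes the factor [Num.sqrt n%:R]. *)
Lemma dist_n_upper (kappa : R) t : 0 < kappa ->
  (forall i, kappa <= p i * a i ^+ 2) -> 1 <= n%:R * min_rate ->
  dist_n k beta blk (t + n.-1)
    <= Num.sqrt (grad_const / kappa) * Num.sqrt n%:R * q ^+ t.
Proof.
move=> k0 kp nr.
have bk0 i j : 0 <= beta * k i j by rewrite mulr_ge0.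
have bkM i j : beta * k i j <= beta * kmax by rewrite ler_wpM2l ?k_le_max.
have rng := flip_rate_range blk n_gt0 k_ge0 beta_ge0 k_le_max.
have lip s v w : v != w -> _ := @flip_rate_lip R m n k beta blk k_sym k_ge0 beta_ge0 s v w.
have flp := flip_rate_flip k beta blk.
set B := Num.sqrt (grad_const / kappa) * q ^+ t.
have G0 : 0 <= grad_const / kappa.
  by rewrite !divr_ge0 ?expR_ge0 ?exprn_ge0 ?(ltW k0) ?(ltW min_rate_gt0).
have B0 : 0 <= B by rewrite mulr_ge0 ?sqrtr_ge0 ?exprn_ge0.
rewrite [leRHS](_ : _ = (2 * B * Num.sqrt n%:R) / 2); last first.
  by rewrite /B; field.
apply: dist_n_le_oscillation => //; first by rewrite mulr_ge0 ?sqrtr_ge0 // mulr_ge0.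
move=> g g1 s u; apply: le_trans (ler_norm _) _.
apply: path_bound => // x.
(* With this c, [n * p i * (c * a i)^2] is [grad_const * p i * a i ^+ 2 / kappa], which is at least
   [grad_const]: the global gradient bound yields the blockwise one. *)
pose c : R := Num.sqrt (grad_const / kappa / n%:R).
have c0 : 0 <= c by apply: sqrtr_ge0.
have c2 : c ^+ 2 = grad_const / kappa / n%:R by rewrite sqr_sqrtr // divr_ge0.
have GB y := @gradsq_iter_bounded R m n _ blk (fun i j => beta * k i j) _
  min_rate_gt0 nr rng flp bk0 lip _ bkM g y (mulr_ge0 beta_ge0 kmax_ge0) g1.
have bb : block_bounded blk a c (iter n.-1 P g).
  move=> y i; apply: le_trans (_ : gradsq (iter n.-1 P g) y <= _).
    rewrite /gradsq [leRHS](bigID (fun v => blk v == i)) /= lerDl.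
    by apply: sumr_ge0 => v _; apply: sqr_ge0.
  apply: le_trans (GB y) _; rewrite -/grad_const blk_card exprMn c2.
  rewrite [leRHS](_ : _ = (n%:R * N) * (grad_const / kappa * (p i * a i ^+ 2))); last by ring.
  have Gc0 : 0 <= grad_const.
    by rewrite divr_ge0 ?expR_ge0 // exprn_ge0 // ltW // min_rate_gt0.
  rewrite nN mul1r; set Gc := grad_const in Gc0 *.
  by rewrite -mulrA ler_peMr // mulrC ler_pdivlMr // mul1r.
have bbt := @block_bounded_iter R m n _ blk (fun i j => beta * k i j) _
  min_rate_gt0 nr rng flp bk0 lip p a lam blk_card (fun i => ltW (a_gt0 i)) eigen t c _ lam_ge0 c0 bb.
rewrite -iterD in bbt.
have := @block_bounded_gradsq R m n blk p a blk_card (fun i => ltW (a_gt0 i)) _ _ x p_sum (fun i => ltW (p_gt0 i)) a1 bbt.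
move/le_trans; apply.
rewrite /B !exprMn c2 sqr_sqrtr //.
rewrite [leLHS](_ : _ = (n%:R * N) * (grad_const / kappa * (q ^+ t) ^+ 2)); last by ring.
by rewrite nN mul1r.
Qed.

(** * Block magnetizations and their one-step drift *)

Definition magn i s : R := N * \sum_(v | blk v == i) spin R (s v).
Definition magn_perron s : R := \sum_i a i * magn i s.
(** The weights [1 / p i] symmetrize the linearized drift, which sends the magnetization vector to
    [p i * beta * mean_field i]. *)
Definition magn_energy s : R := \sum_i magn i s ^+ 2 / p i.

Local Notation tanh_mean i s := (N * \sum_(w | blk w == i) tanhR (beta * S s w)).
Local Notation K := (beta * kmax).

Let K0 : 0 <= K. Proof. by rewrite mulr_ge0 ?kmax_ge0. Qed.

Lemma card_blk_sum i (x : R) : N * \sum_(v | blk v == i) x = p i * x.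
Proof.
rewrite sumr_const -[X in _ * X]mulr_natl (eq_card (B := [pred v | blk v == i])) //.
by rewrite blk_card !mulrA [N * _]mulrC nN mul1r.
Qed.

Lemma dflip_magn v i s :
  dflip v (magn i) s = if blk v == i then - 2 * N * spin R (s v) else 0.
Proof.
rewrite /dflip /magn -mulrBr -sumrB.
case: eqP => [vi|/eqP vi].
  rewrite (bigD1 v) /=; last by rewrite vi.
  rewrite big1 ?addr0 => [|w /andP[_ wv]]; last by rewrite flipE (negbTE wv) subrr.
  by rewrite flipE eqxx spinN; ring.
rewrite big1 ?mulr0 // => w wi; rewrite flipE; case: eqVneq => [wv|_].
  by move: vi; rewrite -wv wi.
by rewrite subrr.
Qed.

Lemma step_magn i s : P (magn i) s = (1 - N) * magn i s + N * tanh_mean i s.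
Proof.
rewrite /step.
have -> : \sum_w flip_rate k beta blk s w * dflip w (magn i) s =
   tanh_mean i s - magn i s.
  rewrite /magn -mulrBr -sumrB mulr_sumr [RHS]big_mkcond; apply: eq_bigr => w _.
  rewrite dflip_magn flip_rateE; case: ifP => _; last by rewrite mulr0.
  by case: (s w); rewrite /spin; field; rewrite pnatr_eq0 -lt0n.
ring.
Qed.

Lemma magn_le i s : `|magn i s| <= p i.
Proof.
rewrite normrM gtr0_norm // -[p i]mulr1 -card_blk_sum ler_wpM2l ?(ltW N0) //.
by apply: le_trans (ler_norm_sum _ _ _) _; apply: ler_sum => v _; rewrite norm_spin.
Qed.

Definition mean_field i s : R := \sum_j k i j * magn j s.

(** The mean field counts the interaction of w with itself, which the local field omits; the
    difference is of order 1/n. *)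
Lemma locfieldE s w :
  S s w = mean_field (blk w) s - k (blk w) (blk w) * N * spin R (s w).
Proof.
have -> : mean_field (blk w) s = \sum_v Kint k blk w v * spin R (s v).
  rewrite [RHS](partition_big blk predT) //=; apply: eq_bigr => j _.
  rewrite /magn mulrA mulr_sumr; apply: eq_bigr => v /eqP vj.
  by rewrite /Kint vj.
by rewrite (bigD1 w) //= addrC addrK.
Qed.

Lemma locfield_mean_field s w :
  `|beta * S s w - beta * mean_field (blk w) s| <= K * N.
Proof.
rewrite locfieldE -mulrBr addrAC subrr add0r normrM normrN normrM norm_spin mulr1.
rewrite !ger0_norm ?mulr_ge0 ?(ltW N0) // mulrA.
by rewrite ler_wpM2r ?(ltW N0) // ler_wpM2l // k_le_max.
Qed.

Lemma mean_field_sqr i s : mean_field i s ^+ 2 <= kmax ^+ 2 * magn_energy s.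
Proof.
have -> : mean_field i s = \sum_j p j * (k i j * magn j s / p j).
  apply: eq_bigr => j _; field; exact: lt0r_neq0.
apply: le_trans (jensen_sqr _ _) _ => [j _|]; first exact: ltW.
rewrite p_sum mul1r /magn_energy mulr_sumr; apply: ler_sum => j _.
have pj := p_gt0 j.
rewrite [leLHS](_ : _ = k i j ^+ 2 * (magn j s ^+ 2 / p j)); last first.
  by field; exact: lt0r_neq0.
rewrite ler_wpM2r //; first by rewrite mulr_ge0 ?sqr_ge0 // invr_ge0 ltW.
by rewrite lerXn2r ?nnegrE ?kmax_ge0 ?k_le_max.
Qed.

Lemma magn_energy_ge0 s : 0 <= magn_energy s.
Proof. by apply: sumr_ge0 => i _; rewrite mulr_ge0 ?sqr_ge0 // invr_ge0 ltW. Qed.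

Lemma magn_perron_sqr s : magn_perron s ^+ 2 <= magn_energy s.
Proof.
apply: le_trans (jensen_sqr _ _) _ => [j _|]; first exact: ltW.
rewrite a_sum mul1r; apply: ler_sum => i _.
rewrite mulrC ler_wpM2l ?sqr_ge0 //; apply: le_trans (a1 i) _.
by rewrite invf_ge1.
Qed.

Lemma tanh_mean_le i s :
  `|tanh_mean i s| <= p i * (beta * `|mean_field i s| + K * N).
Proof.
rewrite normrM gtr0_norm // -card_blk_sum ler_wpM2l ?(ltW N0) //.
apply: le_trans (ler_norm_sum _ _ _) _; apply: ler_sum => w /eqP wi.
have := tanhR_lip (beta * S s w) 0; rewrite tanhR0 !subr0 => /le_trans; apply.
have := locfield_mean_field s w; rewrite wi => H.
rewrite -[beta * S s w](subrK (beta * mean_field i s)).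
apply: le_trans (ler_normD _ _) _; rewrite addrC lerD //.
by rewrite normrM (ger0_norm beta_ge0).
Qed.

(** Two errors add up: the self-interaction, of order 1/n, and the linearization of [tanh], bounded
    through the squared mean field by the energy. *)
Lemma tanh_mean_approx i s :
  `|tanh_mean i s - p i * (beta * mean_field i s)| <= p i * (K * N + K ^+ 2 * magn_energy s).
Proof.
rewrite -!card_blk_sum -mulrBr -sumrB normrM gtr0_norm // ler_wpM2l ?(ltW N0) //.
apply: le_trans (ler_norm_sum _ _ _) _; apply: ler_sum => w /eqP wi.
set h := beta * mean_field i s.
have -> : tanhR (beta * S s w) - h = (tanhR (beta * S s w) - tanhR h) + (tanhR h - h) by ring.
apply: le_trans (ler_normD _ _) _; apply: lerD.
  apply: le_trans (tanhR_lip _ _) _.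
  by have := locfield_mean_field s w; rewrite wi.
apply: le_trans (tanhR_quad _) _; rewrite /h [leLHS]exprMn [K ^+ 2]exprMn -[leRHS]mulrA.
by rewrite ler_wpM2l ?sqr_ge0 // mean_field_sqr.
Qed.

(* Schur test with the Perron vector as test function. *)
Lemma magn_form_le s :
  \sum_i `|magn i s| * (beta * `|mean_field i s|) <= lam * magn_energy s.
Proof.
apply: le_trans (_ : \sum_i \sum_j beta * k i j * (`|magn i s| * `|magn j s|) <= _).
  apply: ler_sum => i _; rewrite mulrA.
  have -> : \sum_j beta * k i j * (`|magn i s| * `|magn j s|)
     = `|magn i s| * beta * \sum_j k i j * `|magn j s|.
    by rewrite mulr_sumr; apply: eq_bigr => j _; ring.
  rewrite ler_wpM2l ?mulr_ge0 //; apply: le_trans (ler_norm_sum _ _ _) _.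
  by apply: ler_sum => j _; rewrite normrM (ger0_norm (k_ge0 _ _)).
pose F i j := beta * k i j * (magn i s ^+ 2 * (p j * a j / (p i * a i))).
have FE i : \sum_j F i j = lam * (magn i s ^+ 2 / p i).
  have ai := a_gt0 i; have pi0 := p_gt0 i.
  have -> : \sum_j F i j = magn i s ^+ 2 / (p i * a i) * \sum_j beta * k i j * p j * a j.
    by rewrite mulr_sumr; apply: eq_bigr => j _; rewrite /F; ring.
  by rewrite eigen; field; rewrite !lt0r_neq0.
have -> : lam * magn_energy s = 2^-1 * (\sum_i \sum_j F i j + \sum_i \sum_j F j i).
  rewrite [X in _ + X]exchange_big /= (eq_bigr _ (fun i _ => FE i)) -mulr_sumr.
  by rewrite -/(magn_energy s); field.
rewrite -big_split mulr_sumr /=; apply: ler_sum => i _.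
rewrite -big_split mulr_sumr /=; apply: ler_sum => j _.
have ai := a_gt0 i; have pi0 := p_gt0 i; have aj := a_gt0 j; have pj0 := p_gt0 j.
rewrite /F [k j i]k_sym.
set c := p j * a j / (p i * a i).
have c0 : 0 < c by rewrite divr_gt0 // mulr_gt0.
have -> : p i * a i / (p j * a j) = c^-1 by rewrite /c invf_div.
rewrite -mulrDr [leRHS]mulrCA ler_wpM2l ?mulr_ge0 // ler_pdivlMl //.
set x := magn i s; set y := magn j s.
rewrite -[x ^+ 2]real_normK ?num_real // -[y ^+ 2]real_normK ?num_real //.
have cK : c * c^-1 = 1 by rewrite mulfV // gt_eqF.
rewrite -subr_ge0 [X in 0 <= X](_ : _ = c^-1 * (c * `|x| - `|y|) ^+ 2).
  by rewrite mulr_ge0 ?sqr_ge0 // invr_ge0 ltW.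
rewrite [RHS](_ : _ = (c * c^-1) * (c * `|x| ^+ 2) - (c * c^-1) * (2 * `|x| * `|y|) + c^-1 * `|y| ^+ 2); last by ring.
rewrite cK; ring.
Qed.

(** The square is expanded around its old value: a drift term, plus squared jumps [(2 / n)^2] that
    occur with probability at most [p i]. *)
Lemma step_magn_sqr i s : P (fun u => magn i u ^+ 2) s <=
  magn i s ^+ 2 + 2 * N * (magn i s * tanh_mean i s - magn i s ^+ 2) + 4 * N ^+ 2 * p i.
Proof.
rewrite /step.
have -> : N * \sum_w flip_rate k beta blk s w * dflip w (fun u => magn i u ^+ 2) s =
  2 * magn i s * (P (magn i) s - magn i s) +
  N * \sum_w flip_rate k beta blk s w * dflip w (magn i) s ^+ 2.
  rewrite /step addrAC subrr add0r mulrCA -mulrDr; congr (_ * _).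
  by rewrite mulr_sumr -big_split /=; apply: eq_bigr => w _; rewrite /dflip; ring.
rewrite step_magn -[leRHS]addrA lerD2l; apply: lerD.
  by rewrite le_eqVlt; apply/orP; left; apply/eqP; ring.
have -> : 4 * N ^+ 2 * p i = N * \sum_w (if blk w == i then 4 * N ^+ 2 else 0).
  by rewrite -big_mkcond card_blk_sum mulrC.
rewrite ler_wpM2l ?(ltW N0) //; apply: ler_sum => w _.
rewrite dflip_magn; case: ifP => _; last by rewrite expr0n mulr0.
have -> : (- 2 * N * spin R (s w)) ^+ 2 = 4 * N ^+ 2.
  by rewrite exprMn [spin _ _ ^+ 2]expr2 spin_sqr; ring.
rewrite ler_piMl ?mulr_ge0 ?sqr_ge0 //.
have /andP[_ /le_trans] := flip_rate_range blk n_gt0 k_ge0 beta_ge0 k_le_max s w.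
by apply; rewrite gerBl ltW // min_rate_gt0.
Qed.

(** The part [2 * K] comes from self-interactions, the part [4 * m] from the jumps in the m
    blocks. *)
Definition energy_const : R := 2 * K + 4 * m%:R.

(** Here [tanh] is bounded by the modulus of its argument instead of being linearized, so the energy
    contracts from every configuration; [magn_form_le] supplies [lam]. *)
Lemma step_magn_energy s : P magn_energy s <=
  (1 - 2 * ((1 - lam) * N)) * magn_energy s + energy_const * N ^+ 2.
Proof.
have -> : P magn_energy s = \sum_i (p i)^-1 * P (fun u => magn i u ^+ 2) s.
  rewrite /step /magn_energy.
  have -> : \sum_i (p i)^-1 * (magn i s ^+ 2 + N * \sum_w flip_rate k beta blk s w *
       dflip w (fun u => magn i u ^+ 2) s) = \sum_i (magn i s ^+ 2 / p i) +
     N * \sum_w \sum_i flip_rate k beta blk s w * (dflip w (fun u => magn i u ^+ 2) s / p i).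
    rewrite [X in _ = _ + _ * X]exchange_big [X in _ = _ + X]mulr_sumr -big_split /=.
    apply: eq_bigr => i _; rewrite mulrDr [(p i)^-1 * (N * _)]mulrCA [(p i)^-1 * _ ^+ 2]mulrC; congr (_ + _ * _).
    by rewrite mulr_sumr; apply: eq_bigr => w _; rewrite mulrC mulrA.
  congr (_ + _ * _); apply: eq_bigr => w _.
  rewrite -mulr_sumr /dflip -sumrB; congr (_ * _).
  by apply: eq_bigr => i _; rewrite mulrBl.
apply: le_trans (_ : \sum_i (magn i s ^+ 2 / p i * (1 - 2 * N) +
   2 * N * (`|magn i s| * (beta * `|mean_field i s|)) + 2 * N * (p i * (K * N)) + 4 * N ^+ 2) <= _).
  apply: ler_sum => i _; have pi0 := p_gt0 i.
  rewrite mulrC ler_pdivrMr //; apply: le_trans (step_magn_sqr i s) _.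
  have H : magn i s * tanh_mean i s <= p i * (`|magn i s| * (beta * `|mean_field i s|) + p i * (K * N)).
    apply: le_trans (ler_norm _) _; rewrite normrM.
    apply: le_trans (ler_wpM2l _ (tanh_mean_le i s)) _ => //.
    rewrite mulrCA ler_wpM2l ?(ltW pi0) // mulrDr lerD2l ler_wpM2r ?magn_le //.
    by rewrite mulr_ge0 // ltW.
  have H2 : 2 * N * (magn i s * tanh_mean i s) <= 2 * N * (p i * (`|magn i s| * (beta * `|mean_field i s|) + p i * (K * N))).
    by rewrite ler_wpM2l // mulr_ge0 // ltW.
  set X := tanh_mean i s in H2 *.
  rewrite [leRHS](_ : _ = magn i s ^+ 2 + (2 * N * (p i * (`|magn i s| * (beta * `|mean_field i s|) + p i * (K * N))) - 2 * N * magn i s ^+ 2) + 4 * N ^+ 2 * p i).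
    by rewrite lerD2r lerD2l mulrBr lerD2r.
  by field; rewrite pnatr_eq0 -lt0n n_gt0 lt0r_neq0.
rewrite !big_split /= -mulr_suml -!mulr_sumr -mulr_suml p_sum mul1r sumr_const card_ord.
rewrite -/(magn_energy s) -[_ *+ m]mulr_natl.
have H := magn_form_le s.
have : 2 * N * (\sum_i `|magn i s| * (beta * `|mean_field i s|)) <= 2 * N * (lam * magn_energy s).
  by rewrite ler_wpM2l // mulr_ge0 // ltW.
set X := \sum_i _; set E := magn_energy s => HX.
rewrite /energy_const; apply: le_trans (_ : E * (1 - 2 * N) + 2 * N * (lam * E) + 2 * N * (K * N) + 4 * (N * (m%:R * N)) <= _).
  by rewrite !lerD2r lerD2l.
by rewrite le_eqVlt; apply/orP; left; apply/eqP; ring.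
Qed.

(** The Perron vector diagonalizes the linear part of the drift, and only the errors of
    [tanh_mean_approx] are lost. *)
Lemma step_magn_perron s :
  q * magn_perron s - N * (K * N + K ^+ 2 * magn_energy s) <= P magn_perron s.
Proof.
have -> : P magn_perron s = \sum_i a i * P (magn i) s.
  rewrite /step /magn_perron.
  have -> : \sum_i a i * (magn i s + N * \sum_w flip_rate k beta blk s w *
       dflip w (magn i) s) = \sum_i (a i * magn i s) +
     N * \sum_w \sum_i flip_rate k beta blk s w * (a i * dflip w (magn i) s).
    rewrite [X in _ = _ + _ * X]exchange_big [X in _ = _ + X]mulr_sumr -big_split /=.
    apply: eq_bigr => i _; rewrite mulrDr; congr (a i * magn i s + _); rewrite [LHS]mulrCA; congr (N * _).
    by rewrite mulr_sumr; apply: eq_bigr => w _; rewrite mulrCA.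
  congr (_ + _ * _); apply: eq_bigr => w _.
  rewrite -mulr_sumr /dflip -sumrB; congr (_ * _).
  by apply: eq_bigr => i _; rewrite mulrBr.
set D := K * N + K ^+ 2 * magn_energy s.
have D0 : 0 <= D by rewrite addr_ge0 // mulr_ge0 ?sqr_ge0 ?magn_energy_ge0 ?K0 ?(ltW N0).
have E : \sum_i a i * (p i * (beta * mean_field i s)) = lam * magn_perron s.
  have -> : \sum_i a i * (p i * (beta * mean_field i s)) =
     \sum_i \sum_j beta * k j i * p i * a i * magn j s.
    apply: eq_bigr => i _; rewrite !mulr_sumr; apply: eq_bigr => j _.
    by rewrite (k_sym j i); ring.
  rewrite exchange_big /= mulr_sumr; apply: eq_bigr => j _.
  by rewrite -mulr_suml eigen mulrA.
apply: le_trans (_ : \sum_i a i * ((1 - N) * magn i s + N * (p i * (beta * mean_field i s) - p i * D)) <= _); last first.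
  apply: ler_sum => i _; rewrite ler_wpM2l ?(ltW (a_gt0 i)) // step_magn lerD2l.
  rewrite ler_wpM2l ?(ltW N0) //.
  have := tanh_mean_approx i s; rewrite ler_norml -/D => /andP[H _].
  by move: H; rewrite lerBrDr addrC.
have -> : \sum_i a i * ((1 - N) * magn i s + N * (p i * (beta * mean_field i s) - p i * D))
  = (1 - N) * magn_perron s + N * (lam * magn_perron s) - N * (D * \sum_i a i * p i).
  rewrite -E /magn_perron !mulr_sumr -big_split -sumrB /=.
  by apply: eq_bigr => i _; ring.
have H : N * (D * \sum_i a i * p i) <= N * D.
  rewrite ler_wpM2l ?(ltW N0) // ler_piMr //.
  by rewrite -a_sum; apply: ler_sum => i _; rewrite ler_piMr // ltW.
rewrite [q * _](_ : _ = (1 - N) * magn_perron s + N * (lam * magn_perron s)); last by ring.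
by rewrite lerD2l lerN2.
Qed.

(** * Mean and variance of the Perron projection along the chain *)

Definition lyap_weight : R := K ^+ 2 / (1 - lam).
(** A loss of [(K + lyap_weight * energy_const) * N ^+ 2] per step, contracted at rate
    [(1 - lam) * N], accumulates to at most [drift_const * N]. *)
Definition drift_const : R := (K + lyap_weight * energy_const) / (1 - lam).
(** The sum of the constants bounding the variance along the chain and the second moment at
    equilibrium. *)
Definition moment_const : R := (4 + energy_const / 2) / (1 - lam).

Let gap0 : 0 < 1 - lam. Proof. by rewrite subr_gt0. Qed.
Let gap_neq0 : 1 - lam != 0. Proof. by rewrite gt_eqF. Qed.
Let n_neq0 : n%:R != 0 :> R. Proof. by rewrite pnatr_eq0 -lt0n. Qed.

Lemma energy_const_ge0 : 0 <= energy_const.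
Proof. by rewrite addr_ge0 // mulr_ge0. Qed.

Lemma lyap_weight_ge0 : 0 <= lyap_weight.
Proof. by rewrite divr_ge0 ?sqr_ge0 // ltW. Qed.

Let f01 s w : 0 <= flip_rate k beta blk s w <= 1.
Proof.
have /andP[h1 h2] := flip_rate_range blk n_gt0 k_ge0 beta_ge0 k_le_max s w.
have r0 := min_rate_gt0.
rewrite (le_trans (ltW r0) h1) /=.
by apply: le_trans h2 _; rewrite gerBl ltW.
Qed.

(* The weight of the energy is chosen so that its contraction, at twice the rate of the linear part, absorbs the quadratic error of the linearization. *)
Lemma step_lyap s :
  q * (magn_perron s - lyap_weight * magn_energy s)
    - (K + lyap_weight * energy_const) * N ^+ 2
  <= P (fun u => magn_perron u + (- lyap_weight) * magn_energy u) s.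
Proof.
rewrite stepD stepZ.
have H1 := step_magn_perron s.
have H2 := ler_wpM2l lyap_weight_ge0 (step_magn_energy s).
rewrite mulNr; apply: le_trans (lerB H1 H2).
rewrite le_eqVlt; apply/orP; left; apply/eqP.
have E : lyap_weight * (1 - lam) = K ^+ 2 by rewrite /lyap_weight divfK // gt_eqF.
rewrite -E; ring.
Qed.

Lemma iter_magn_perron_ge t s :
  q ^+ t * (magn_perron s - lyap_weight * magn_energy s) - drift_const * N
    <= iter t P magn_perron s.
Proof.
set F := fun u => magn_perron u + (- lyap_weight) * magn_energy u.
apply: le_trans (_ : iter t P F s <= _); last first.
  apply: le_iter_step => // u; rewrite /F gerDl mulNr oppr_le0.
  by rewrite mulr_ge0 ?lyap_weight_ge0 ?magn_energy_ge0.
have B0 : 0 <= drift_const.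
  by rewrite divr_ge0 ?(ltW gap0) // addr_ge0 // mulr_ge0 ?lyap_weight_ge0 ?energy_const_ge0.
have FE u : F u = magn_perron u - lyap_weight * magn_energy u by rewrite /F mulNr.
rewrite -FE; elim: t => [|t IH].
  by rewrite expr0 mul1r /= gerBl mulr_ge0 // ltW.
set c := (K + lyap_weight * energy_const) * N ^+ 2.
(* The new step is taken innermost, so that the one-step inequality for F is averaged by the
   monotone operator [P^t]. *)
rewrite iterSr; apply: le_trans (_ : q * iter t P F s - c <= _).
  apply: le_trans (_ : q * (q ^+ t * F s - drift_const * N) - c <= _).
    have -> : c = drift_const * N * ((1 - lam) * N).
      rewrite /c /drift_const; field.
      by rewrite ?gap_neq0 ?n_neq0.
    by rewrite exprS le_eqVlt; apply/orP; left; apply/eqP; ring.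
  by rewrite lerD2r ler_wpM2l.
rewrite -iter_stepZ -(iter_step_cst (flip_rate k beta blk) t (- c) s) -iter_stepD.
apply: le_iter_step => // u; rewrite FE; exact: step_lyap.
Qed.

(** Equality holds: a flip in block i changes the projection by [2 * N * a i] in modulus. *)
Lemma magn_perron_block_bounded : block_bounded blk a (2 * N) magn_perron.
Proof.
move=> s i; rewrite le_eqVlt; apply/orP; left; apply/eqP.
rewrite (eq_bigr (fun=> (2 * N * a i) ^+ 2)).
  by rewrite sumr_const [RHS]mulr_natl; congr (_ *+ _); apply: eq_card.
move=> v /eqP vi.
have -> : dflip v magn_perron s = a i * (- 2 * N * spin R (s v)).
  rewrite /dflip /magn_perron -sumrB (bigD1 i) //= big1 ?addr0.
    by rewrite -mulrBr; congr (_ * _); have := dflip_magn v i s; rewrite /dflip vi eqxx.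
  move=> j ji; rewrite -mulrBr; have := dflip_magn v j s; rewrite /dflip => ->.
  by rewrite vi eq_sym (negbTE ji) mulr0.
rewrite exprMn [(_ * spin _ _) ^+ 2]exprMn [spin _ _ ^+ 2]expr2 spin_sqr; ring.
Qed.

(** The one-step variance of [P^i magn_perron] is at most [4 * N ^+ 2 * q ^+ (2 * i)] by the
    gradient contraction, and the geometric sum is at most [n / (1 - lam)], uniformly in t. *)
Lemma magn_perron_variance t s : 1 <= n%:R * min_rate ->
  iter t P (fun u => magn_perron u ^+ 2) s - iter t P magn_perron s ^+ 2
    <= 4 / (1 - lam) * N.
Proof.
move=> nr; rewrite iter_step_variance.
have bk0 i j : 0 <= beta * k i j by rewrite mulr_ge0.
have rng := flip_rate_range blk n_gt0 k_ge0 beta_ge0 k_le_max.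
have lip s' v w : v != w -> _ := @flip_rate_lip R m n k beta blk k_sym k_ge0 beta_ge0 s' v w.
have flp := flip_rate_flip k beta blk.
have q1 : q < 1 by rewrite gtrBl mulr_gt0.
have c0 : 0 <= 2 * N by rewrite mulr_ge0 // ltW.
apply: le_trans (_ : \sum_(i < t) 4 * N ^+ 2 * q ^+ i <= _); last first.
  rewrite -mulr_sumr; apply: le_trans (ler_wpM2l _ (sum_geometric_le t q0 q1)) _.
    by rewrite mulr_ge0 ?sqr_ge0.
  rewrite opprB addrCA subrr addr0 le_eqVlt; apply/orP; left; apply/eqP.
  by field; rewrite ?gap_neq0 ?n_neq0.
apply: ler_sum => i _.
rewrite -[leRHS](iter_step_cst (flip_rate k beta blk) (t.-1 - i) _ s).
apply: le_iter_step => // u; apply: le_trans (step_variance_le f01 _ _) _.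
have bbt := @block_bounded_iter R m n _ blk (fun i j => beta * k i j) _
  min_rate_gt0 nr rng flp bk0 lip p a lam blk_card (fun i => ltW (a_gt0 i)) eigen i _ _ lam_ge0 c0 magn_perron_block_bounded.
have GB := @block_bounded_gradsq R m n blk p a blk_card (fun i => ltW (a_gt0 i)) _ _ u p_sum (fun i => ltW (p_gt0 i)) a1 bbt.
apply: le_trans (ler_wpM2l (ltW N0) GB) _.
rewrite mulrA [N * _]mulrC nN mul1r exprMn [(2 * N) ^+ 2]exprMn.
rewrite [leLHS](_ : _ = 4 * N ^+ 2 * (q ^+ i) ^+ 2); last by ring.
rewrite ler_wpM2l ?mulr_ge0 ?sqr_ge0 // expr2 ler_piMr ?exprn_ge0 //.
by rewrite exprn_ile1 // ltW.
Qed.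

(** The equilibrium mean of the energy is invariant under one step, so the drift inequality can be
    solved for it. *)
Lemma gibbs_magn_perron_sqr :
  \sum_u gibbs k beta blk u * magn_perron u ^+ 2 <= energy_const / (2 * (1 - lam)) * N.
Proof.
apply: le_trans (_ : \sum_u gibbs k beta blk u * magn_energy u <= _).
  by apply: ler_sum => u _; rewrite ler_wpM2l ?gibbs_ge0 ?magn_perron_sqr.
set E := \sum_u _.
have : E <= (1 - 2 * ((1 - lam) * N)) * E + energy_const * N ^+ 2.
  rewrite {1}/E -(gibbs_stationary blk n_gt0 k_sym beta_ge0).
  apply: le_trans (_ : \sum_u gibbs k beta blk u * ((1 - 2 * ((1 - lam) * N)) * magn_energy u + energy_const * N ^+ 2) <= _).
    by apply: ler_sum => u _; rewrite ler_wpM2l ?gibbs_ge0 ?step_magn_energy.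
  have -> : \sum_u gibbs k beta blk u * ((1 - 2 * ((1 - lam) * N)) * magn_energy u + energy_const * N ^+ 2)
    = (1 - 2 * ((1 - lam) * N)) * E + energy_const * N ^+ 2 * \sum_u gibbs k beta blk u.
    rewrite !mulr_sumr -big_split /=; apply: eq_bigr => u _; ring.
  by rewrite sum_gibbs mulr1.
move=> H; rewrite -(@ler_pM2l _ (2 * ((1 - lam) * N))); last by rewrite !mulr_gt0.
rewrite [leRHS](_ : _ = energy_const * N ^+ 2); first by move: H; lra.
by field; rewrite ?gap_neq0 ?n_neq0.
Qed.

(** * Starting configuration and lower bound on the distance *)

Lemma exists_magn (delta : R) : 0 < delta -> delta < 1 ->
  exists s, forall i, delta * p i <= magn i s <= delta * p i + 2 * N.
Proof.
move=> d0 d1.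
(* Having [n * p i * (1 + delta) / 2] plus spins in block i gives magnetization [delta * p i].
   Rounding up costs at most 2/n, and [delta < 1] leaves enough sites. *)
pose h i := (Num.truncn (n%:R * p i * (1 + delta) / 2)).+1.
have x0 i : 0 <= n%:R * p i * (1 + delta) / 2.
  by rewrite !mulr_ge0 ?(ltW (p_gt0 i)) // addr_ge0 // ltW.
have hB i : n%:R * p i * (1 + delta) / 2 <= (h i)%:R <= n%:R * p i * (1 + delta) / 2 + 1.
  have /andP[t1 t2] := truncn_itv (x0 i).
  by rewrite (ltW t2) /h -addn1 natrD lerD2r t1.
have hc i : (h i <= #|[pred v | blk v == i]|)%N.
  rewrite /h -(@ltr_nat R) blk_card.
  apply: le_lt_trans (_ : n%:R * p i * (1 + delta) / 2 < _).
    by have /andP[] := truncn_itv (x0 i).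
  by rewrite ltr_pdivrMr // ltr_pM2l ?mulr_gt0 ?ltr0n // ltrD2l.
have /boolp.choice[B HB] : forall i, exists B : {set 'I_n},
    {subset B <= [pred v | blk v == i]} /\ #|B| = h i.
  by move=> i; have [B B1 B2] := subset_with_card (hc i); exists B.
exists [ffun v => v \in B (blk v)] => i.
have [Bsub Bcard] := HB i.
have -> : magn i [ffun v => v \in B (blk v)] = N * (2 * (h i)%:R - n%:R * p i).
  congr (_ * _); rewrite -blk_card -Bcard.
  have -> : \sum_(v | blk v == i) spin R ([ffun v => v \in B (blk v)] v) =
    \sum_(v | blk v == i) (2 * (v \in B i)%:R - 1).
    by apply: eq_bigr => v /eqP vi; rewrite ffunE vi; case: (v \in B i) => /=; rewrite ?mulr1 ?mulr0; ring.
  rewrite sumrB -mulr_sumr sumr_const; congr (2 * _ - _).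
  rewrite -natr_sum -sum1_card; congr (_%:R).
  rewrite big_mkcond [RHS]big_mkcond; apply: eq_bigr => v _ /=.
  case: (boolP (v \in B i)) => [/Bsub|]; first by rewrite inE => ->.
  by case: ifP.
have /andP[h1 h2] := hB i.
have e1 : delta * p i = N * (2 * (n%:R * p i * (1 + delta) / 2) - n%:R * p i).
  by field; rewrite pnatr_eq0 -lt0n.
rewrite e1 [2 * N]mulrC -mulrDr !ler_pM2l //.
by move: h1 h2; lra.
Qed.

Definition overlap : R := \sum_i a i * p i.
(** Collects the effect on the energy of rounding the block magnetizations. *)
Definition round_const : R := \sum_i (4 + 4 / p i).

Lemma exists_start (delta : R) : 0 < delta -> delta < 1 ->
  exists s, delta * overlap - lyap_weight * (delta ^+ 2 + round_const * N)
    <= magn_perron s - lyap_weight * magn_energy s.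
Proof.
move=> d0 d1; have [s Hs] := exists_magn d0 d1; exists s; apply: lerB.
  rewrite /overlap mulr_sumr; apply: ler_sum => i _; rewrite mulrCA.
  by rewrite ler_wpM2l ?(ltW (a_gt0 i)) //; have /andP[] := Hs i.
rewrite ler_wpM2l ?lyap_weight_ge0 //.
have -> : delta ^+ 2 + round_const * N = \sum_i (delta ^+ 2 * p i + (4 + 4 / p i) * N).
  by rewrite big_split /= -mulr_sumr p_sum mulr1 mulr_suml.
apply: ler_sum => i _; have pi0 := p_gt0 i.
apply: le_trans (_ : (delta * p i + 2 * N) ^+ 2 / p i <= _).
  have /andP[h1 h2] := Hs i.
  have m0 : 0 <= magn i s by apply: le_trans h1; rewrite mulr_ge0 // ltW.
  rewrite ler_wpM2r ?invr_ge0 ?(ltW pi0) // lerXn2r ?nnegrE //.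
  exact: le_trans h2.
rewrite [leLHS](_ : _ = delta ^+ 2 * p i + (4 * delta + 4 / p i * N) * N); last first.
  by field; rewrite ?n_neq0 ?lt0r_neq0.
rewrite lerD2l ler_wpM2r ?(ltW N0) //; apply: lerD.
  by rewrite ler_piMr // ltW.
by rewrite ler_piMr // divr_ge0 // ltW.
Qed.

(** L is a signal-to-noise ratio: the mean is at least [L * Num.sqrt N], while the two second-moment
    bounds add up to [moment_const * N]. *)
Lemma dist_n_lower (delta L : R) t : 0 < delta -> delta < 1 ->
  1 <= n%:R * min_rate -> 0 < L ->
  L * Num.sqrt N <= q ^+ t * (delta * overlap - lyap_weight * (delta ^+ 2 + round_const * N))
     - drift_const * N ->
  1 - 4 * moment_const / L ^+ 2 <= dist_n k beta blk t.
Proof.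
move=> d0 d1 nr L0 HL.
have [s Hs] := exists_start d0 d1.
have ML : L * Num.sqrt N <= iter t P magn_perron s.
  apply: le_trans (iter_magn_perron_ge t s); apply: le_trans HL _.
  by rewrite lerD2r ler_wpM2l // exprn_ge0.
have LN0 : 0 < L * Num.sqrt N by rewrite mulr_gt0 // sqrtr_gt0.
have M0 := lt_le_trans LN0 ML.
have := dist_n_ge_moments n_gt0 M0 (magn_perron_variance t s nr) gibbs_magn_perron_sqr.
apply: le_trans; rewrite lerD2l lerN2.
have M2 : L ^+ 2 * N <= iter t P magn_perron s ^+ 2.
  have -> : L ^+ 2 * N = (L * Num.sqrt N) ^+ 2 by rewrite exprMn sqr_sqrtr // ltW.
  by rewrite lerXn2r ?nnegrE // ltW.
have L2 : 0 < L ^+ 2 by rewrite exprn_gt0.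
have mc0 : 0 <= moment_const.
  by rewrite divr_ge0 ?(ltW gap0) // addr_ge0 // divr_ge0 // energy_const_ge0.
rewrite -mulrDl [X in 4 * (X * _)](_ : _ = moment_const); last first.
  by rewrite /moment_const; field; rewrite gap_neq0.
rewrite ler_pdivrMr ?exprn_gt0 //.
have h0 : 0 <= 4 * moment_const / L ^+ 2 by rewrite divr_ge0 ?(ltW L2) // mulr_ge0.
apply: le_trans (ler_wpM2l h0 M2).
by rewrite le_eqVlt; apply/orP; left; apply/eqP; field; rewrite n_neq0 gt_eqF.
Qed.

End Model.

(** * Exponential estimates and limits along filters *)

Section Asymptotics.
Context {R : realType}.
Implicit Types (x y g C : R).

Lemma sqrt_natr_expR n : (0 < n)%N -> Num.sqrt n%:R = expR (ln n%:R / 2) :> R.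
Proof.
move=> n0; rewrite -[n%:R in LHS]lnK ?posrE ?ltr0n //.
have -> : expR (ln n%:R) = expR (ln n%:R / 2) ^+ 2 :> R.
  by rewrite -expRM_natl; congr expR; field.
by rewrite sqrtr_sqr ger0_norm // expR_ge0.
Qed.

Lemma exprB1_le_expR x t : x <= 1 -> (1 - x) ^+ t <= expR (- (t%:R * x)).
Proof.
move=> x1; rewrite -mulrN expRM_natl lerXn2r ?nnegrE ?subr_ge0 ?expR_ge0 //.
exact: expR_ge1Dx.
Qed.

(* 1 / (1 - x) = 1 + x / (1 - x) <= exp (x / (1 - x)). *)
Lemma exprB1_ge_expR x t : 0 <= x -> x <= 2^-1 ->
  expR (- (t%:R * (x + 2 * x ^+ 2))) <= (1 - x) ^+ t.
Proof.
move=> x0 x2; have x1 : 0 < 1 - x by lra.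
rewrite -mulrN expRM_natl lerXn2r ?nnegrE ?expR_ge0 ?(ltW x1) //.
rewrite expRN invf_ple ?posrE ?expR_gt0 //.
apply: le_trans (_ : expR (x / (1 - x)) <= _).
  rewrite [leLHS](_ : _ = 1 + x / (1 - x)); last by field; rewrite gt_eqF.
  exact: expR_ge1Dx.
rewrite ler_expR ler_pdivrMr //.
rewrite -subr_ge0 [X in 0 <= X](_ : _ = x ^+ 2 * (1 - 2 * x)); last by ring.
by rewrite mulr_ge0 ?sqr_ge0 //; lra.
Qed.

Lemma limf_esup_le {T : choiceType} {X : filteredType T} (f : X -> \bar R)
  (F : set_system X) (M : \bar R) :
  F [set x | f x <= M]%E -> (limf_esup f F <= M)%E.
Proof.
move=> H; rewrite limf_esupE; apply: le_trans (ereal_inf_lbound _) _.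
  by exists [set x | f x <= M]%E.
by apply: ge_ereal_sup => _ [x /= xM <-].
Qed.

Lemma limf_einf_ge {T : choiceType} {X : filteredType T} (f : X -> \bar R)
  (F : set_system X) (M : \bar R) :
  F [set x | M <= f x]%E -> (M <= limf_einf f F)%E.
Proof.
move=> H; rewrite limf_einfE; apply: le_trans (ereal_sup_ubound _); last first.
  by exists [set x | M <= f x]%E.
by apply: le_ereal_inf_tmp => _ [x /= xM <-].
Qed.

Lemma limf_einf_le {T : choiceType} {X : filteredType T} (f : X -> \bar R)
  (F : set_system X) (M : \bar R) :
  (forall V, F V -> exists2 u, V u & (f u <= M)%E) -> (limf_einf f F <= M)%E.
Proof.
move=> H; rewrite limf_einfE; apply: ge_ereal_sup => _ [V /H[u Vu fM] <-].
by apply: le_trans (ereal_inf_lbound _) fM; exists u.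
Qed.

Lemma cvg_expR_decay C g : 0 < g ->
  (fun x => C * expR (- (g * x))) @ +oo --> (0 : R).
Proof.
move=> g0; rewrite -[X in _ --> X](mulr0 C); apply: cvgMl_tmp.
apply: (@cvg_comp _ _ _ (fun x => g * x) (fun y => expR (- y)) +oo +oo (nbhs (0 : R))).
  by apply: gt0_cvgMry => //; exact: cvg_id.
exact: cvgr_expR.
Qed.

(** The inverse of one plus the sum of inverses is an explicit witness, also for an empty index
    type. *)
Lemma exists_pos_lower_bound {I : finType} (F : I -> R) : (forall i, 0 < F i) ->
  exists2 c : R, 0 < c & forall i, c <= F i.
Proof.
move=> F0; have S0 : 0 <= \sum_i (F i)^-1.
  by apply: sumr_ge0 => i _; rewrite invr_ge0 ltW.
exists (1 + \sum_i (F i)^-1)^-1 => [|i]; first by rewrite invr_gt0 ltr_pwDl.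
rewrite invf_ple ?posrE ?ltr_pwDl //.
rewrite (bigD1 i) //= addrCA lerDl addr_ge0 // sumr_ge0 // => j _.
by rewrite invr_ge0 ltW.
Qed.

End Asymptotics.

(** * Both sides of the cutoff at explicit times *)

Section Cutoff.
Context {R : realType} {m : nat} (p a : 'I_m -> R) (k : 'M[R]_m) (beta lam : R).
Context (blk : forall n, 'I_n -> 'I_m).

Hypothesis p_gt0 : forall i, 0 < p i.
Hypothesis p_sum : \sum_i p i = 1.
Hypothesis a_gt0 : forall i, 0 < a i.
Hypothesis a_sum : \sum_i a i = 1.
Hypothesis k_sym : forall i j, k i j = k j i.
Hypothesis k_ge0 : forall i j, 0 <= k i j.
Hypothesis beta_ge0 : 0 <= beta.
Hypothesis lam_ge0 : 0 <= lam.
Hypothesis lam_lt1 : lam < 1.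
Hypothesis eigen : forall i, \sum_j beta * k i j * p j * a j = lam * a i.
Hypothesis blk_card : forall n, valid p n ->
  forall i, #|[pred v | @blk n v == i]|%:R = n%:R * p i.

Local Notation gap := (1 - lam).
Local Notation mixing n := (ln n%:R / (2 * gap) * n%:R).
Local Notation d n x := (dist_n k beta (@blk n) (Num.truncn (x : R))).

Let gap0 : 0 < gap. Proof. by rewrite subr_gt0. Qed.
Let gap1 : gap <= 1. Proof. by rewrite gerBl. Qed.

Lemma cutoff_upper : exists C : R, forall n (gamma : R), valid p n ->
  1 <= n%:R * min_rate k beta -> 1 <= gamma ->
  d n (mixing n + gamma * n%:R) <= C * expR (- (gap * gamma)).
Proof.
have [kappa k0 kp] : exists2 c : R, 0 < c & forall i, c <= p i * a i ^+ 2.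
  by apply: exists_pos_lower_bound => i; rewrite mulr_gt0 // exprn_gt0.
(* The factor [expR gap] pays for the [n.-1] smoothing steps, which shift gamma by one. *)
exists (Num.sqrt (grad_const k beta / kappa) * expR gap) => n gamma nv nr g1.
have n0 : (0 < n)%N by case: nv.
have nR : 0 < n%:R :> R by rewrite ltr0n.
set x := mixing n + _.
have mx0 : 0 <= mixing n.
  by rewrite !mulr_ge0 ?ln_ge0 ?ler1n // invr_ge0 mulr_ge0 // ltW.
have x0 : n%:R <= x.
  by rewrite -[leLHS]add0r lerD // ler_peMl.
have /andP[t1 t2] := truncn_itv (le_trans (ltW nR) x0).
set N := Num.truncn x in t1 t2 *.
have Nn : (n.-1 <= N)%N.
  by have := le_lt_trans x0 t2; rewrite ltr_nat; lia.
rewrite -(subnK Nn).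
apply: le_trans (dist_n_upper p_gt0 p_sum a_gt0 a_sum k_sym k_ge0 beta_ge0 lam_ge0 eigen n0 (blk_card nv) (N - n.-1) k0 kp nr) _.
rewrite -!mulrA ler_wpM2l ?sqrtr_ge0 // -expRD sqrt_natr_expR //.
(* Truncation loses less than one step, and only [n - 1] steps are spent on smoothing, so together
   at most n are missing. *)
have tB : mixing n + (gamma - 1) * n%:R <= (N - n.-1)%:R.
  rewrite natrB // -subn1 natrB //.
  by move: t2; rewrite -addn1 natrD /x; lra.
have y1 : gap / n%:R <= 1.
  rewrite ler_pdivrMr // mul1r; apply: le_trans gap1 _; by rewrite ler1n.
apply: le_trans (ler_wpM2l (expR_ge0 _) (exprB1_le_expR _ y1)) _.
rewrite -expRD ler_expR.
have := ler_wpM2r (ltW (divr_gt0 gap0 nR)) tB.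
have -> : (mixing n + (gamma - 1) * n%:R) * (gap / n%:R) = ln n%:R / 2 + (gamma - 1) * gap.
  by field; rewrite !gt_eqF.
by set y := _%:R * _; lra.
Qed.

(** C is fixed before gamma, so that the bound tends to one as gamma grows; only the threshold X on
    the size depends on gamma. *)
Lemma cutoff_lower : (0 < m)%N -> exists C : R, forall gamma : R, 0 <= gamma ->
  exists X : R, forall n, valid p n -> X <= n%:R ->
  1 - C * expR (- (2 * gap * gamma)) <= d n (mixing n - gamma * n%:R).
Proof.
move=> m0.
have s0 : 0 < overlap p a.
  rewrite /overlap (bigD1 (Ordinal m0)) //= ltr_pwDl ?mulr_gt0 //.
  by apply: sumr_ge0 => i _; rewrite mulr_ge0 // ltW.
have s1 : overlap p a <= 1.
  rewrite -a_sum; apply: ler_sum => i _; rewrite ler_piMr ?(ltW (a_gt0 i)) //.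
  by rewrite -p_sum (bigD1 i) //= lerDl sumr_ge0 // => j _; apply: ltW.
set s := overlap p a in s0 s1.
set A := lyap_weight k beta lam.
have A0 : 0 <= A by apply: lyap_weight_ge0.
(* Small enough that the energy penalty [A * delta ^+ 2] takes at most half of the linear gain
   [delta * s]. *)
pose delta := s / (2 * (A + 1)).
have d0 : 0 < delta by rewrite divr_gt0 // mulr_gt0 // ltr_wpDl.
have dA : delta * (2 * (A + 1)) = s by rewrite /delta divfK // gt_eqF // mulr_gt0 // ltr_wpDl.
have d1 : delta < 1.
  have : 0 <= delta * A by rewrite mulr_ge0 // ltW.
  by move: dA; lra.
(* Of the gain [4 * eps], the penalty takes at most [2 * eps] and the rounding at most [eps]. *)
pose eps := delta * s / 4.
have e0 : 0 < eps by rewrite divr_gt0 // mulr_gt0.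
set dc := drift_const k beta lam.
set mc := moment_const k beta lam.
(* The factor 1/2 leaves room for [drift_const], the [- 1] in the exponent for the quadratic term of
   [exprB1_ge_expR]. *)
pose L gamma := eps / 2 * expR (gap * gamma - 1).
exists (4 * mc / (eps / 2 * expR (- 1)) ^+ 2) => gamma g0.
have L0 : 0 < L gamma by rewrite mulr_gt0 ?expR_gt0 // divr_gt0.
(* Each summand serves one requirement: [gap / n <= 1/2], the rate condition, a nonnegative time,
   the rounding error, and the drift error. *)
exists (2 + (min_rate k beta)^-1 + expR (2 * gap * gamma) + `|A * round_const p| / eps
   + dc ^+ 2 / L gamma ^+ 2) => n nv Xn.
have r0 : 0 < (min_rate k beta)^-1 by rewrite invr_gt0 min_rate_gt0.
have c0 := expR_gt0 (2 * gap * gamma).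
have h0 : 0 <= `|A * round_const p| / eps by rewrite divr_ge0 // ltW.
have h1 : 0 <= dc ^+ 2 / L gamma ^+ 2 by rewrite divr_ge0 ?sqr_ge0.
have X2 : 2 <= n%:R :> R by lra.
have Xr : (min_rate k beta)^-1 <= n%:R by lra.
have Xe : expR (2 * gap * gamma) <= n%:R by lra.
have XA : `|A * round_const p| / eps <= n%:R by lra.
have XL : dc ^+ 2 / L gamma ^+ 2 <= n%:R by lra.
have n0 : (0 < n)%N by case: nv.
have nR : 0 < n%:R :> R by rewrite ltr0n.
have nr : 1 <= n%:R * min_rate k beta.
  by rewrite mulrC -ler_pdivrMl ?min_rate_gt0 // mulr1.
have lnn : 2 * gap * gamma <= ln n%:R.
  by rewrite -[leLHS]expRK ler_ln ?posrE ?expR_gt0.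
set x := mixing n - _.
have x0 : 0 <= x.
  rewrite /x -mulrBl mulr_ge0 // subr_ge0 ler_pdivlMr ?mulr_gt0 //.
  by rewrite mulrC.
have /andP[t1 _] := truncn_itv x0.
set T := Num.truncn x in t1 *.
have -> : 4 * mc / (eps / 2 * expR (- 1)) ^+ 2 * expR (- (2 * gap * gamma)) = 4 * mc / L gamma ^+ 2.
  have -> : expR (- (2 * gap * gamma)) = (expR (gap * gamma) * expR (gap * gamma))^-1.
    by rewrite -expRD -expRN; congr expR; ring.
  rewrite /L expRD; move: (expR_gt0 (gap * gamma)) (expR_gt0 (- 1 : R)).
  set E := expR (gap * gamma); set F := expR (- 1) => E0 F0.
  by field; rewrite !gt_eqF.
have yE : (1 - gap / n%:R) ^+ T >= expR (gap * gamma - 1) * Num.sqrt n%:R^-1.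
  have y0 : 0 <= gap / n%:R by rewrite divr_ge0 // ltW.
  have y2 : gap / n%:R <= 2^-1 by rewrite ler_pdivrMr //; move: gap1 X2; lra.
  apply: le_trans (exprB1_ge_expR T y0 y2).
  rewrite sqrtrV ?ler0n // sqrt_natr_expR // -expRN -expRD ler_expR.
  set y := gap / n%:R in y0 y2 *.
  have yn : n%:R * y = gap by rewrite mulrC divfK // gt_eqF.
  have Ty : T%:R * y <= ln n%:R / 2 - gap * gamma.
    apply: le_trans (ler_wpM2r y0 t1) _.
    rewrite /x mulrBl -[_ * n%:R * y]mulrA -[gamma * _ * y]mulrA yn.
    by rewrite le_eqVlt; apply/orP; left; apply/eqP; field; rewrite gt_eqF.
  have Tyy : T%:R * y * y <= ln n%:R / 2 * y.
    apply: ler_wpM2r => //; apply: le_trans Ty _.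
    by rewrite gerBl mulr_ge0 // ltW.
  (* [ln n] is below n, and [n * y] is the gap, which is at most one. *)
  have lny : ln n%:R * y <= 1.
    apply: le_trans (ler_wpM2r y0 (ltW (ln_sublinear nR))) _.
    by rewrite yn.
  have -> : T%:R * (y + 2 * y ^+ 2) = T%:R * y + 2 * (T%:R * y * y) by ring.
  by move: Ty Tyy lny; set u := T%:R * y; lra.
have lowL : L gamma * Num.sqrt n%:R^-1 <=
    (1 - gap / n%:R) ^+ T * (delta * s - A * (delta ^+ 2 + round_const p * n%:R^-1))
     - dc * n%:R^-1.
  set N := n%:R^-1.
  have N0 : 0 < N by rewrite invr_gt0.
  have E1 : eps <= delta * s - A * (delta ^+ 2 + round_const p * N).
    have H1 : A * delta ^+ 2 <= delta * s / 2.
      have -> : delta * s / 2 = A * delta ^+ 2 + delta ^+ 2 by rewrite -[s]dA; field.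
      by rewrite lerDl sqr_ge0.
    have H2 : A * (round_const p * N) <= eps.
      apply: le_trans (ler_norm _) _; rewrite mulrA normrM (gtr0_norm N0).
      by rewrite /N ler_pdivrMr // [leRHS]mulrC -ler_pdivrMr.
    move: H1 H2; rewrite mulrDr; set B := A * (_ * N).
    have -> : delta * s = 4 * eps by rewrite /eps; field.
    by lra.
  have E2 : dc * N <= L gamma * Num.sqrt N.
    apply: le_trans (ler_norm _) _.
    rewrite -(@ler_pXn2r _ 2) ?nnegrE ?normr_ge0 ?(mulr_ge0 (ltW L0) (sqrtr_ge0 _)) //.
    rewrite real_normK ?num_real // [leLHS]exprMn [leRHS]exprMn sqr_sqrtr ?(ltW N0) //.
    rewrite ler_pdivrMr ?exprn_gt0 // in XL.
    apply: le_trans (ler_wpM2r (sqr_ge0 N) XL) _.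
    by rewrite le_eqVlt; apply/orP; left; apply/eqP; rewrite /N; field; rewrite gt_eqF.
  have sN : 0 <= Num.sqrt N by apply: sqrtr_ge0.
  have E3 : 2 * L gamma * Num.sqrt N <= (1 - gap / n%:R) ^+ T * eps.
    have := ler_wpM2r (ltW e0) yE; apply: le_trans.
    by rewrite /L le_eqVlt; apply/orP; left; apply/eqP; rewrite /N; field.
  have E4 : (1 - gap / n%:R) ^+ T * eps <= (1 - gap / n%:R) ^+ T * (delta * s - A * (delta ^+ 2 + round_const p * N)).
    apply: ler_wpM2l E1; apply: le_trans yE; rewrite mulr_ge0 ?expR_ge0 ?sqrtr_ge0 //.
  move: E2 E3 E4; set U := _ ^+ T * (_ - _); set V := _ ^+ T * eps; lra.
exact: (dist_n_lower p_gt0 p_sum a_gt0 a_sum k_sym k_ge0 beta_ge0 lam_ge0 lam_lt1 eigen n0 (blk_card nv) d0 d1 nr L0 lowL).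
Qed.

End Cutoff.

(** * Identification of the Perron eigenvalue and passage to the limit *)

Theorem theorem3p1 (R : realType) (m : nat) (p : 'I_m -> R) (k : 'M[R]_m)
  (beta : R) (blk : forall n : nat, 'I_n -> 'I_m) (a : 'rV[R]_m) :
  (0 < m)%N ->
  (forall i, 0 < p i) -> \sum_i p i = 1 ->
  (forall i j, k i j = k j i) ->
  (forall i j, i != j -> 0 < k i j) ->
  (forall i, 0 <= k i i) ->
  (forall N : nat, exists n : nat, (N <= n)%N /\ valid p n) ->
  (forall n, valid p n -> forall i, (#|[pred v | blk n v == i]|)%:R = n%:R * p i) ->
  (forall i, 0 < a 0 i) -> \sum_i a 0 i = 1 ->
  (forall n : nat, (0 < n)%N -> a *m Qmat p k beta n = perron (Qmat p k beta n) *: a) ->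
  0 <= beta -> beta < beta_cr p k a ->
  (fun gamma : R => limf_esup
      (fun n : nat => (dist_n k beta (blk n)
                         (Num.truncn (tn p k beta n + gamma * n%:R)))%:E)
      (within (valid p) \oo)) @ +oo --> 0%E
  /\
  (fun gamma : R => limf_einf
      (fun n : nat => (dist_n k beta (blk n)
                         (Num.truncn (tn p k beta n - gamma * n%:R)))%:E)
      (within (valid p) \oo)) @ +oo --> 1%E.
Proof.
move=> m0 p0 p1 ks kpos kd validI blkc a0 a1 Hperron b0 bcr.
have k0 i j : 0 <= k i j.
  by have [->|/kpos/ltW] := eqVneq i j.
pose B := \sum_i \sum_j a 0 i * p i * k i j.
pose lam := beta * B.
have B0 : 0 <= B.
  by do 2![apply: sumr_ge0 => ? _]; rewrite !mulr_ge0 // ltW.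
have lam0 : 0 <= lam by rewrite mulr_ge0.
have lam1 : lam < 1.
  (* For [B = 0] the convention [0^-1 = 0] gives [beta_cr = 0], which contradicts
     [0 <= beta < beta_cr]. *)
  move: bcr; rewrite /beta_cr -/B; have [->|Bn] := eqVneq B 0.
    by rewrite invr0 ltNge b0.
  by rewrite -[_^-1]mul1r ltr_pdivlMr // lt0r Bn B0.
have QE n j : (0 < n)%N -> (1 - n%:R^-1) * a 0 j
    + beta / n%:R * \sum_i a 0 i * p i * k i j = perron (Qmat p k beta n) * a 0 j.
  move=> n0; have := Hperron n n0 => /(congr1 (fun A : 'rV_m => A 0 j)).
  rewrite [RHS]mxE => <-.
  rewrite /Qmat mulmxDr -!scalemxAr mulmx1 !mxE; congr (_ + _ * _).
  by apply: eq_bigr => i _; rewrite /Bmat mxE mulrA.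
(* Adding the coordinates of the eigenvector equation, with [a] of sum one, determines the
   eigenvalue. *)
have rho n : (0 < n)%N -> perron (Qmat p k beta n) = 1 - (1 - lam) / n%:R.
  move=> n0; rewrite -[LHS]mulr1 -a1 mulr_sumr.
  under eq_bigr => j _ do rewrite -QE //.
  rewrite big_split /= -!mulr_sumr a1 exchange_big /= -/B /lam; ring.
(* At [n = 1] the matrix [Qmat] is [beta] times [Bmat] and its Perron value is [lam]; symmetry of k
   exchanges rows and columns. *)
have eigen i : \sum_j beta * k i j * p j * a 0 j = lam * a 0 i.
  have := QE 1%N i isT; rewrite rho // !invr1 subrr mul0r add0r !mulr1.
  rewrite opprB addrCA subrr addr0 => <-.
  by rewrite mulr_sumr; apply: eq_bigr => j _; rewrite (ks i j); ring.
have tnE n : (0 < n)%N -> tn p k beta n = ln n%:R / (2 * (1 - lam)) * n%:R.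
  move=> n0; rewrite /tn /alpha rho //.
  by field; rewrite gt_eqF ?subr_gt0 // pnatr_eq0 -lt0n.
have g0 : 0 < 1 - lam by rewrite subr_gt0.
(* Admissible sizes are unbounded, so the filter is proper and the upper limit of nonnegative
   numbers is nonnegative. *)
have F0 : ~ within (valid p) \oo set0.
  move=> [N _ HN]; have [n [Nn nv]] := validI N.
  exact: HN Nn nv.
have nearV (S : set nat) : (\forall n \near \oo, valid p n -> S n) -> within (valid p) \oo S by [].
split.
  have [C HC] := cutoff_upper p0 p1 a0 a1 ks k0 b0 lam0 lam1 eigen blkc.
  apply: (@squeeze_cvge _ _ _ _ (fun=> 0%E) _
    (fun x => (C * expR (- ((1 - lam) * x)))%:E)); last 2 first.
  - exact: cvg_cst.
  - apply: cvg_EFin; [exact: nearW|exact: cvg_expR_decay].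
  near=> gamma; apply/andP; split.
    by apply: limf_esup_ge0 => // n; rewrite lee_fin dist_n_ge0.
  have g1 : 1 <= gamma by near: gamma; apply: nbhs_pinfty_ge; exact: num_real.
  apply: limf_esup_le; apply: nearV; near=> n => nv /=.
  have n0 : (0 < n)%N by case: nv.
  rewrite lee_fin tnE //; apply: HC => //.
  rewrite mulrC -ler_pdivrMl ?min_rate_gt0 // mulr1.
  by near: n; exact: nbhs_infty_ger.
have [C HC] := cutoff_lower p0 p1 a0 a1 ks k0 b0 lam0 lam1 eigen blkc m0.
apply: (@squeeze_cvge _ _ _ _ (fun x => (1 - C * expR (- (2 * (1 - lam) * x)))%:E) _
    (fun=> 1%E)); last 2 first.
- apply: cvg_EFin; first exact: nearW.
  rewrite -[X in _ --> X]subr0; apply: cvgB; first exact: cvg_cst.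
  by apply: cvg_expR_decay; rewrite mulr_gt0.
- exact: cvg_cst.
near=> gamma; apply/andP; split.
  have [|X HX] := HC gamma.
    by near: gamma; apply: nbhs_pinfty_ge; exact: num_real.
  apply: limf_einf_ge; apply: nearV; near=> n => nv /=.
  have n0 : (0 < n)%N by case: nv.
  rewrite lee_fin tnE //; apply: HX => //.
  by near: n; exact: nbhs_infty_ger.
(* One admissible size in each set of the filter suffices to bound the lower limit by one. *)
apply: limf_einf_le => V [N _ HN]; have [n [Nn nv]] := validI N.
by exists n; [exact: HN|rewrite lee_fin dist_n_le1 //; case: nv].
Unshelve. all: by end_near.
Qed.
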